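(* Let $X=X(\Delta)$ be a complete $T$-cellular toric variety and let $\{f_i\}_{i=1}^m$ be the basis of $K^0_{T_{comp}}(X)$ over $R(T_{comp})$ described in the context. Let $f\in K^0_{T_{comp}}(X)$ and write $$f=\sum_{j=1}^m a_j\cdot f_j,\qquad a_j\in R(T_{comp})\ \text{ for } 1\le j\le m.$$ Then the coefficients are determined iteratively (by descending induction on $i$) by the closed formula $$a_i=\frac{\Big[f-\sum_{j=i+1}^{m}a_j\cdot f_j\Big]\Big|_{x_i}}{\prod_{r=1}^{n-k_i}(1-e^{-u_{i_r}})}\qquad\text{for } 1\le i\le m.$$
   Context: $T\simeq(\mathbb{C}^* )^n$ is a complex algebraic torus, $T_{comp}\simeq(S^1)^n$ its maximal compact subgroup, $N\simeq\mathbb{Z}^n$ the lattice of one-parameter subgroups of $T$ and $M=\mathrm{Hom}(N,\mathbb{Z})$ the lattice of characters. The representation ring of $T_{comp}$ is the integral domain $R(T_{comp})=\mathbb{Z}[M]=\mathbb{Z}[e^u: u\in M]$; quotients are taken in its fraction field. $X(\Delta)$ is the complex toric variety with dense torus $T$ associated to a fan $\Delta$ in $N$. For a compact $T_{comp}$-space $X$, $K^0_{T_{comp}}(X)$ is the Grothendieck ring of $T_{comp}$-equivariant complex topological vector bundles on $X$; it is an $R(T_{comp})$-algebra via $[V]\mapsto[X\times V]$. For a $T$-fixed point $x_l$, $f|_{x_l}\in K^0_{T_{comp}}(x_l)=R(T_{comp})$ is the restriction of $f$ to $x_l$. Definition of $T$-cellular: let $X$ be a normal complex algebraic $T$-variety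 with finite fixed point set $X^T=\{x_1,\ldots,x_m\}$. A one-parameter subgroup $\lambda$ of $T$ is generic if $X^{\lambda}=X^T$. The plus cell of $x_i$ is $X_+(x_i,\lambda)=\{x\in X\mid \lim_{t\to0}\lambda(t)x \text{ exists and equals } x_i\}$. $X$ is $T$-cellular if for some fixed generic $\lambda$, and a suitable ordering of the fixed points: (i) $X$ is the union of the plus cells $Y_i:=X_+(x_i,\lambda)$; (ii) there is a decreasing sequence of $T$-invariant closed subvarieties $X=Z_1\supset Z_2\supset\cdots\supset Z_m\supset Z_{m+1}=\emptyset$ with $Z_i\setminus Z_{i+1}=Y_i$; (iii) each $Y_i$ is $T$-equivariantly isomorphic to an affine space with a linear $T$-action. Write $Y_i\cong\mathbb{C}^{n-k_i}$, as a $T$-representation the direct sum of the one-dimensional representations with characters $u_{i_j}\in M$, $1\le j\le n-k_i$. The $f_i\in K^0_{T_{comp}}(X)$, $1\le i\le m$, form an $R(T_{comp})$-module basis of $K^0_{T_{comp}}(X)$ satisfying $f_i|_{x_i}=\prod_{j=1}^{n-k_i}(1-e^{-u_{i_j}})$ and $f_i|_{x_l}=0$ for all $l>i$ (they are chosen so that the restriction of $f_i$ to $K^0_{T_{comp}}(Z_i)$ is the image of the Thom class of $Y_i$ under the extension map $K^0_{T_{comp},c}(Y_i)\to K^0_{T_{comp}}(Z_i)$, where $K^0_{T_{comp},c}$ is equivariant $K$-theory with compact support). *)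

(* Defs.v *)
From HB Require Import structures.
From Stdlib Require Import Relation_Operators.
From mathcomp Require Import all_boot all_order all_algebra finmap.
From mathcomp Require Import ring.
From mathcomp Require Import -(notations) monalg.
From mathcomp Require Import all_classical reals topology normedtype fsbigop.
From mathcomp Require Import complex mxtens fraction.

Set Implicit Arguments.
Unset Strict Implicit.
Unset Printing Implicit Defensive.

Import Order.TTheory GRing.Theory Num.Theory numFieldNormedType.Exports.
Local Open Scope classical_set_scope.
Local Open Scope ring_scope.
Local Open Scope quotient_scope.

Section CharacterRing.
Variable n : nat.
Local Notation M := 'rV[int]_n.

(* Z[M] for M = Z^n: finitely supported functions M -> Z. The library makes
   monoid algebras rings only over monoids without nontrivial units, so the
   convolution product is defined here. *)
Definition charring := monalg.malg M int.
HB.instance Definition _ := GRing.Zmodule.copy charring (monalg.malg M int).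
Implicit Types (g h : charring) (u v : M).

Definition expc u : charring := monalg.mkmalgU u 1.
Definition coefc g u : int := monalg.mcoeff u g.
Definition suppc g : {fset M} := monalg.msupp g.

Local Notation U := (@monalg.mkmalgU M int).

Definition mulc g h : charring :=
  \sum_(u <- suppc g) \sum_(v <- suppc h) U (u + v) (coefc g u * coefc h v).

Lemma coefc_out g u : u \notin suppc g -> coefc g u = 0.
Proof. exact: monalg.mcoeff_outdom. Qed.

Lemma mulcw (d1 d2 : {fset M}) g h :
  (suppc g `<=` d1)%fset -> (suppc h `<=` d2)%fset ->
  mulc g h =
    \sum_(u <- d1) \sum_(v <- d2) U (u + v) (coefc g u * coefc h v).
Proof.
move=> le1 le2; rewrite /mulc (big_fset_incl _ le1) /=.
  apply: eq_bigr => u _; apply: big_fset_incl => // v _ /coefc_out ->.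
  by rewrite mulr0 monalg.monalgU0.
move=> u _ /coefc_out gu; rewrite big1 // => v _.
by rewrite gu mul0r monalg.monalgU0.
Qed.

Lemma mulcC : commutative mulc.
Proof.
move=> g h; rewrite /mulc exchange_big /=; apply: eq_bigr => u _.
by apply: eq_bigr => v _; rewrite addrC mulrC.
Qed.

Lemma mul0c : left_zero 0 mulc.
Proof. by move=> g; rewrite /mulc /suppc monalg.msupp0 big_seq_fset0. Qed.

Lemma mulcUg c u g :
  mulc (U u c) g = \sum_(v <- suppc g) U (u + v) (c * coefc g v).
Proof.
rewrite (mulcw monalg.msuppU_le (fsubset_refl _)) big_seq_fset1.
by apply: eq_bigr => v _; rewrite /coefc monalg.mcoeffUU.
Qed.

Lemma mulcUU c d u v : mulc (U u c) (U v d) = U (u + v) (c * d).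
Proof.
by rewrite (mulcw monalg.msuppU_le monalg.msuppU_le) !big_seq_fset1 /coefc
  !monalg.mcoeffUU.
Qed.

Lemma mulcE g h : mulc g h = \sum_(u <- suppc g) mulc (U u (coefc g u)) h.
Proof. by apply: eq_bigr => u _; rewrite mulcUg. Qed.

Lemma mul1c : left_id (expc 0) mulc.
Proof.
move=> g; rewrite mulcUg [RHS]monalg.monalgE.
by apply: eq_bigr => v _; rewrite mul1r add0r.
Qed.

Lemma mulcDl : left_distributive mulc +%R.
Proof.
move=> g1 g2 g; have fr := fsubset_refl (suppc g).
rewrite [in RHS](mulcw (fsubsetUl _ (suppc g2)) fr).
rewrite [in RHS](mulcw (fsubsetUr (suppc g1) _) fr).
rewrite (mulcw (monalg.msuppD_le _ _) fr).
rewrite -big_split /=; apply: eq_bigr => u _.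
rewrite -big_split /=; apply: eq_bigr => v _.
by rewrite /coefc monalg.mcoeffD mulrDl monalg.monalgUD.
Qed.

Lemma mulcDr : right_distributive mulc +%R.
Proof. by move=> g g1 g2; rewrite !(mulcC g) mulcDl. Qed.

Lemma mulc0 : right_zero 0 mulc.
Proof. by move=> g; rewrite mulcC mul0c. Qed.

Lemma mulc_suml I (r : seq I) (F : I -> charring) h :
  mulc (\sum_(i <- r) F i) h = \sum_(i <- r) mulc (F i) h.
Proof. exact: (big_morph (mulc^~ h) (fun x y => mulcDl x y h) (mul0c h)). Qed.

Lemma mulc_sumr I (r : seq I) (F : I -> charring) h :
  mulc h (\sum_(i <- r) F i) = \sum_(i <- r) mulc h (F i).
Proof. exact: (big_morph (mulc h) (fun x y => mulcDr h x y) (mulc0 h)). Qed.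

Lemma mulcA : associative mulc.
Proof.
move=> g1 g2 g3; rewrite (mulcE g1 g2) mulc_suml mulcE.
apply: eq_bigr => u _; rewrite [mulc g2 g3]mulcE [mulc _ g2]mulcUg mulc_suml.
rewrite mulc_sumr; apply: eq_bigr => v _.
rewrite [mulc (U v _) _]mulcUg mulc_sumr mulcUg; apply: eq_bigr => w _.
by rewrite mulcUU mulrA addrA.
Qed.

Lemma expc0_neq0 : expc 0 != 0.
Proof. by rewrite monalg.monalgU_eq0 oner_eq0. Qed.

HB.instance Definition _ := GRing.Zmodule_isComNzRing.Build charring
  mulcA mulcC mul1c mulcDl expc0_neq0.

(* For the lexicographic order on Z^n, the product of the leading terms of two
   nonzero elements cannot cancel; hence Z[M] is a domain. *)
Definition lexkey u : n.-tuplelexi int := [tuple u 0 i | i < n].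

Lemma lexkey_inj : injective lexkey.
Proof.
move=> u v /(congr1 (fun t => tnth t)) e; apply/rowP => i.
by have := congr1 (@^~ i) e; rewrite !tnth_mktuple.
Qed.

Lemma lexkey_add w u v :
  (lexkey u < lexkey v)%O -> (lexkey (u + w) < lexkey (v + w))%O.
Proof.
move=> /ltxi_tupleP[k kP].
apply/ltxi_tupleP; exists k => i /kP.
by rewrite !tnth_mktuple !mxE /Order.leif /= lerD2r (inj_eq (addIr _)).
Qed.

Lemma lexkey_max (A : {fset M}) : A != fset0 ->
  exists2 u, u \in A & forall v, v \in A -> v != u -> (lexkey v < lexkey u)%O.
Proof.
case/fset0Pn => u0 Au0.
case: (@Order.TotalTheory.arg_maxP _ _ A [` Au0]%fset predT (fun x => lexkey (val x)) isT).
move=> u _ umax; exists (val u); first exact: valP.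
move=> v Av nvu; rewrite lt_neqAle (inj_eq lexkey_inj) nvu /=.
exact: (umax [` Av]%fset).
Qed.

Lemma charring_domain g h : g * h = 0 -> (g == 0) || (h == 0).
Proof.
move=> gh0; apply/norP => -[g0 h0].
have supp0 k : k != 0 -> suppc k != fset0.
  apply: contraNneq => k0; apply/eqP/monalg.malgP => u.
  by rewrite monalg.mcoeff0 [LHS]coefc_out // k0.
have [u gu umax] := lexkey_max (supp0 _ g0).
have [v hv vmax] := lexkey_max (supp0 _ h0).
have : coefc (g * h) (u + v) = coefc g u * coefc h v.
  rewrite [g * h]/(mulc g h) /mulc /coefc raddf_sum /= (big_fsetD1 u) //=.
  rewrite raddf_sum /= (big_fsetD1 v) //= monalg.mcoeffUU.
  rewrite big1_fset; last first.
    move=> w; rewrite in_fsetD1 => /andP[wv hw] _.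
    by rewrite monalg.mcoeffU (inj_eq (addrI u)) (negPf wv).
  rewrite addr0 big1_fset ?addr0 // => x; rewrite in_fsetD1 => /andP[xu gx] _.
  rewrite raddf_sum big1_fset //= => y hy _; rewrite monalg.mcoeffU.
  case: eqP => // e; have := lexkey_add y (umax _ gx xu); rewrite e.
  have [->|yv] := eqVneq y v; first by rewrite ltxx.
  have := lexkey_add u (vmax _ hy yv); rewrite [y + u]addrC [v + u]addrC.
  by move=> lt1 lt2; have := lt_trans lt1 lt2; rewrite ltxx.
rewrite gh0 /coefc monalg.mcoeff0 => /esym/eqP; rewrite mulf_eq0.
by rewrite !monalg.mcoeff_eq0 gu hv.
Qed.

Definition unitc : pred charring := fun g => `[< exists h, h * g = 1 >].
Definition invc g : charring :=
  if unitc g then xget 0 [set h | h * g = 1] else g.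

Lemma mulVc : {in unitc, left_inverse 1 invc *%R}.
Proof.
move=> g gU; rewrite /invc ifT //; move: gU => /asboolP ex.
exact: (xgetPex 0 ex).
Qed.

Lemma unitcPl g h : h * g = 1 -> unitc g.
Proof. by move=> hg; apply/asboolP; exists h. Qed.

Lemma invc_out : {in [predC unitc], invc =1 id}.
Proof. by move=> g; rewrite inE /= /invc /in_mem /= => /negPf ->. Qed.

HB.instance Definition _ := GRing.ComNzRing_hasMulInverse.Build charring
  mulVc unitcPl invc_out.
HB.instance Definition _ := GRing.ComUnitRing_isIntegral.Build charring
  charring_domain.
End CharacterRing.

(* the Grothendieck ring of a commutative semiring *)
Section Grothendieck.
Variable S : comPzSemiRingType.
Implicit Types p q r : S * S.

Definition groth_rel p q : bool :=
  `[< exists g : S, p.1 + q.2 + g = q.1 + p.2 + g >].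

Lemma groth_rel_refl : reflexive groth_rel.
Proof. by move=> p; apply/asboolP; exists 0. Qed.

Lemma groth_rel_sym : symmetric groth_rel.
Proof. by move=> p q; apply/asboolP/asboolP => -[g e]; exists g. Qed.

Lemma groth_rel_trans : transitive groth_rel.
Proof.
move=> q p r /asboolP[g e1] /asboolP[h e2]; apply/asboolP.
exists (q.1 + q.2 + g + h).
transitivity ((p.1 + q.2 + g) + (q.1 + r.2 + h)); first by ring.
by rewrite e1 e2; ring.
Qed.

Canonical groth_equiv :=
  EquivRel groth_rel groth_rel_refl groth_rel_sym groth_rel_trans.

Definition groth := {eq_quot groth_equiv}.
HB.instance Definition _ := Choice.on groth.
HB.instance Definition _ := EqQuotient.on groth.

Definition gdiff p : groth := \pi p.

Lemma gdiffP p q :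
  (exists g : S, p.1 + q.2 + g = q.1 + p.2 + g) <-> gdiff p = gdiff q.
Proof. by split=> [e|/eqquotP /asboolP //]; exact/eqquotP/asboolP. Qed.

Lemma gdiffK (x : groth) : gdiff (repr x) = x.
Proof. exact: reprK. Qed.

Lemma gdiff_repr p :
  exists g, (repr (gdiff p)).1 + p.2 + g = p.1 + (repr (gdiff p)).2 + g.
Proof. by apply/gdiffP; rewrite gdiffK. Qed.

Definition groth_add (x y : groth) : groth :=
  let p := repr x in let q := repr y in gdiff (p.1 + q.1, p.2 + q.2).
Definition groth_opp (x : groth) : groth :=
  let p := repr x in gdiff (p.2, p.1).
Definition groth_mul (x y : groth) : groth :=
  let p := repr x in let q := repr y in
  gdiff (p.1 * q.1 + p.2 * q.2, p.1 * q.2 + p.2 * q.1).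

Lemma gdiffD p q :
  groth_add (gdiff p) (gdiff q) = gdiff (p.1 + q.1, p.2 + q.2).
Proof.
apply/gdiffP => /=.
have [g1 e1] := gdiff_repr p; have [g2 e2] := gdiff_repr q.
exists (g1 + g2).
transitivity (((repr (gdiff p)).1 + p.2 + g1) +
              ((repr (gdiff q)).1 + q.2 + g2)); first by ring.
by rewrite e1 e2; ring.
Qed.

Lemma gdiffN p : groth_opp (gdiff p) = gdiff (p.2, p.1).
Proof.
apply/gdiffP => /=; have [g e] := gdiff_repr p; exists g.
transitivity (p.1 + (repr (gdiff p)).2 + g); first by ring.
by rewrite -e; ring.
Qed.

Lemma gdiffM p q :
  groth_mul (gdiff p) (gdiff q) =
    gdiff (p.1 * q.1 + p.2 * q.2, p.1 * q.2 + p.2 * q.1).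
Proof.
apply/gdiffP => /=.
have := gdiff_repr p; have := gdiff_repr q.
move: (repr _) (repr _) => [a' b'] [c' d']; case: p q => a b [c d] /=.
move=> [g e1] [h e2].
exists (g * (a' + b') + h * (c + d) + (a' + b') * (c + d)).
transitivity ((c' + d + g) * a' + (c + d' + g) * b'
   + (a' + b + h) * c + (a + b' + h) * d); first by ring.
transitivity ((c + d' + g) * a' + (c' + d + g) * b'
   + (a + b' + h) * c + (a' + b + h) * d); last by ring.
by rewrite e1 e2.
Qed.

Lemma groth_addA : associative groth_add.
Proof.
move=> x y z; rewrite -[x]gdiffK -[y]gdiffK -[z]gdiffK !gdiffD /=.
by rewrite !addrA.
Qed.

Lemma groth_addC : commutative groth_add.
Proof.
move=> x y; rewrite -[x]gdiffK -[y]gdiffK !gdiffD.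
by rewrite addrC [_.2 + _]addrC.
Qed.

Lemma groth_add0 : left_id (gdiff (0, 0)) groth_add.
Proof. by move=> x; rewrite -[x]gdiffK gdiffD /= !add0r; case: (repr x). Qed.

Lemma groth_addN : left_inverse (gdiff (0, 0)) groth_opp groth_add.
Proof.
move=> x; rewrite -[x]gdiffK gdiffN gdiffD; apply/gdiffP; exists 0 => /=.
by ring.
Qed.

HB.instance Definition _ :=
  GRing.isZmodule.Build groth groth_addA groth_addC groth_add0 groth_addN.

Lemma groth_mulA : associative groth_mul.
Proof.
move=> x y z; rewrite -[x]gdiffK -[y]gdiffK -[z]gdiffK !gdiffM /=.
by congr (gdiff (_, _)); ring.
Qed.

Lemma groth_mulC : commutative groth_mul.
Proof.
move=> x y; rewrite -[x]gdiffK -[y]gdiffK !gdiffM /=.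
by congr (gdiff (_, _)); ring.
Qed.

Lemma groth_mul1 : left_id (gdiff (1, 0)) groth_mul.
Proof.
move=> x; rewrite -[x]gdiffK gdiffM /= !mul1r !mul0r !addr0.
by case: (repr x).
Qed.

Lemma groth_mulDl : left_distributive groth_mul groth_add.
Proof.
move=> x y z; rewrite -[x]gdiffK -[y]gdiffK -[z]gdiffK.
rewrite gdiffD !gdiffM gdiffD /=.
by congr (gdiff (_, _)); ring.
Qed.

HB.instance Definition _ := GRing.Zmodule_isComPzRing.Build groth
  groth_mulA groth_mulC groth_mul1 groth_mulDl.

Definition gclass (a : S) : groth := gdiff (a, 0).

Lemma gclassD a b : gclass (a + b) = gclass a + gclass b.
Proof. by rewrite [RHS]gdiffD /= addr0. Qed.

Lemma gclassM a b : gclass (a * b) = gclass a * gclass b.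
Proof. by rewrite [RHS]gdiffM /= !(mul0r, mulr0, addr0). Qed.

Lemma gclass1 : gclass 1 = 1. Proof. by []. Qed.
End Grothendieck.

(* C stands for the field of complex numbers. Coordinates are
   fixed on the torus: T = (C^* )^n and N = M = Z^n, paired by the dot product. *)
Section Torus.
Variables (C : numFieldType) (n : nat).

Record torus := Torus {
  tval :> 'rV[C]_n;
  _ : [forall i, tval 0 i != 0] }.
HB.instance Definition _ := [isSub for tval].
HB.instance Definition _ := [Choice of torus by <:].
HB.instance Definition _ := Topological.copy torus (initial_topology tval).
Implicit Types (s t : torus) (u v : 'rV[int]_n).

Lemma torus_neq0 t i : t 0 i != 0. Proof. by case: t => t /= /forallP. Qed.

Fact torus1_subproof : [forall i, (const_mx 1 : 'rV[C]_n) 0 i != 0].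
Proof. by apply/forallP => i; rewrite mxE oner_eq0. Qed.
Definition torus1 : torus := Torus torus1_subproof.

Fact torusM_subproof s t : [forall i, (\row_j (s 0 j * t 0 j)) 0 i != 0].
Proof. by apply/forallP => i; rewrite mxE mulf_neq0 ?torus_neq0. Qed.
Definition torusM s t : torus := Torus (torusM_subproof s t).

(* the character e^u of T, for u in M = Z^n *)
Definition chi u t : C := \prod_i t 0 i ^ u 0 i.

Lemma chi0 t : chi 0 t = 1.
Proof. by rewrite /chi big1 // => i _; rewrite mxE expr0z. Qed.

Lemma chiD u v t : chi (u + v) t = chi u t * chi v t.
Proof.
rewrite /chi -big_split /=; apply: eq_bigr => i _.
by rewrite mxE expfzDr // torus_neq0.
Qed.

Lemma chi1 u : chi u torus1 = 1.
Proof. by rewrite /chi big1 // => i _; rewrite mxE exp1rz. Qed.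

Lemma chiM u s t : chi u (torusM s t) = chi u s * chi u t.
Proof.
rewrite /chi -big_split /=; apply: eq_bigr => i _.
by rewrite mxE expfzMl.
Qed.

(* The one-parameter subgroup s |-> (s^(l_1), ..., s^(l_n)) of T, for l in
   N = Z^n and s <> 0; the value at s = 0 is irrelevant. *)
Fact ops_subproof (l : 'rV[int]_n) (s : C) :
  [forall i, (\row_j ((if s == 0 then 1 else s) ^ l 0 j)) 0 i != 0].
Proof.
apply/forallP => i; rewrite mxE expfz_neq0 //.
by have [_|//] := eqVneq s 0; rewrite oner_neq0.
Qed.
Definition ops (l : 'rV[int]_n) (s : C) : torus := Torus (ops_subproof l s).

Definition tcomp : set torus := [set t | forall i, `|t 0 i| = 1].

Lemma tcomp1 : tcomp torus1.
Proof. by move=> i; rewrite mxE normr1. Qed.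

Lemma tcompM s t : tcomp s -> tcomp t -> tcomp (torusM s t).
Proof. by move=> sc tc i; rewrite mxE normrM sc tc mulr1. Qed.

Lemma tval_continuous : continuous (tval : torus -> 'rV[C]_n).
Proof. exact: initial_continuous. Qed.

Lemma chi_continuous u : continuous (chi u).
Proof.
move=> t.
change ((\prod_i s 0 i ^ u 0 i) @[s --> t] --> \prod_i t 0 i ^ u 0 i).
apply: (cvg_big (@mul_continuous C) (F := nbhs t)) => i _.
have ct : (tval s 0 i) @[s --> t] --> t 0 i.
  exact: (continuous_comp (tval_continuous (x := t)) (@coord_continuous _ _ _ 0 i _)).
case: (u 0 i) => k /=.
  elim: k => [|k IHk]; first by rewrite expr0z; exact: cvg_cst.
  rewrite exprSz; under eq_fun do rewrite exprSz.
  exact: cvgM.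
apply: (cvgV (f := fun s : torus => s 0 i ^+ k.+1)).
  by rewrite expf_neq0 ?torus_neq0.
elim: k => [|k IHk] //.
rewrite exprS; under eq_fun do rewrite exprS.
exact: cvgM.
Qed.

End Torus.

Section CvgMatrix.
Variables (C : numFieldType) (T : Type) (F : set_system T).
Context {FF : Filter F}.

Lemma cvg_mx p q (f : T -> 'M[C]_(p, q)) (A : 'M[C]_(p, q)) :
  (forall i j, f x i j @[x --> F] --> A i j) -> f @ F --> A.
Proof.
move=> fA B [P PA sPB]; rewrite nbhs_simpl /=.
have : \forall x \near F, forall ij : 'I_p * 'I_q, P ij.1 ij.2 (f x ij.1 ij.2).
  apply: filter_forall => -[i j]; exact: (fA i j _ (PA i j)).
by apply: filterS => x Px; apply: sPB => i j; exact: (Px (i, j)).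
Qed.

Lemma cvg_mxE p q (f : T -> 'M[C]_(p, q)) (A : 'M[C]_(p, q)) :
  f @ F --> A -> forall i j, f x i j @[x --> F] --> A i j.
Proof.
move=> fA i j.
apply: (@cvg_comp _ _ _ f (fun B : 'M[C]_(p, q) => B i j) _ _ _ fA).
exact: coord_continuous.
Qed.

Lemma cvg_mulmx p q r (f : T -> 'M[C]_(p, q)) (g : T -> 'M[C]_(q, r))
    (A : 'M[C]_(p, q)) (B : 'M[C]_(q, r)) :
  f @ F --> A -> g @ F --> B -> f x *m g x @[x --> F] --> A *m B.
Proof.
move=> fA gB; apply: cvg_mx => i j; rewrite mxE.
under eq_fun do rewrite mxE.
apply: (cvg_big (@add_continuous C)) => k _.
by apply: cvgM; exact: cvg_mxE.
Qed.

Lemma cvg_dsummx p q r s (f : T -> 'M[C]_(p, q)) (g : T -> 'M[C]_(r, s))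
    (A : 'M[C]_(p, q)) (B : 'M[C]_(r, s)) :
  f @ F --> A -> g @ F --> B ->
  block_mx (f x) 0 0 (g x) @[x --> F] --> block_mx A 0 0 B.
Proof.
move=> fA gB; apply: cvg_mx => i j.
case: (split_ordP i) => a ->; case: (split_ordP j) => b ->.
- by rewrite block_mxEul; under eq_fun do rewrite block_mxEul; exact: cvg_mxE.
- by rewrite block_mxEur; under eq_fun do rewrite block_mxEur; exact: cvg_cst.
- by rewrite block_mxEdl; under eq_fun do rewrite block_mxEdl; exact: cvg_cst.
by rewrite block_mxEdr; under eq_fun do rewrite block_mxEdr; exact: cvg_mxE.
Qed.

Lemma cvg_tensmx p q r s (f : T -> 'M[C]_(p, q)) (g : T -> 'M[C]_(r, s))
    (A : 'M[C]_(p, q)) (B : 'M[C]_(r, s)) :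
  f @ F --> A -> g @ F --> B -> (f x *t g x)%R @[x --> F] --> A *t B.
Proof.
move=> fA gB; apply: cvg_mx => i j; rewrite mxE.
under eq_fun do rewrite mxE.
by apply: cvgM; exact: cvg_mxE.
Qed.
End CvgMatrix.

Section Bundles.
Variables (C : numFieldType) (n : nat) (X : topologicalType).
Variable act : torus C n -> X -> X.

(* T_comp-equivariant complex vector bundles on X. As a vector space the fibre
   E_x is C^(rk x): a basis of every fibre is chosen, with no continuity.
   - The topology is given by trivializations triv a : E|_(nbd a) -> C^(rk a)
     over an open neighbourhood nbd a of each point a of X, with inverse
     cotriv a and continuous transition functions.
   - If y = t.x, then lin t x y is the matrix of t : E_x -> E_y; otherwise it
     is meaningless. Taking y as an argument avoids transport along
     (st).x = s.(t.x). *)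
Record eqbundle := EqBundle {
  rk : X -> nat;
  nbd : X -> set X;
  triv : forall a x, 'M[C]_(rk a, rk x);
  cotriv : forall a x, 'M[C]_(rk x, rk a);
  lin : torus C n -> forall x y, 'M[C]_(rk y, rk x);
  nbd_open : forall a, open (nbd a);
  nbd_self : forall a, nbd a a;
  trivK : forall a x, nbd a x -> cotriv a x *m triv a x = 1%:M;
  cotrivK : forall a x, nbd a x -> triv a x *m cotriv a x = 1%:M;
  triv_cont : forall a b x, nbd a x -> nbd b x ->
    triv b y *m cotriv a y @[y --> x] --> triv b x *m cotriv a x;
  lin1 : forall x, lin (torus1 C n) x x = 1%:M;
  linM : forall s t x y z, tcomp s -> tcomp t -> y = act t x -> z = act s y ->
    lin (torusM s t) x z = lin s y z *m lin t x y;
  lin_cont : forall a b t x, tcomp t -> nbd a x -> nbd b (act t x) ->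
    triv b (act p.1 p.2) *m lin p.1 p.2 (act p.1 p.2) *m cotriv a p.2
      @[p --> within [set p : torus C n * X | tcomp p.1] (nbhs (t, x))]
    --> triv b (act t x) *m lin t x (act t x) *m cotriv a x }.

Implicit Types E F G : eqbundle.

Definition bundle_map E F (h : forall x, 'M[C]_(rk F x, rk E x)) :=
  (forall a b x, nbd E a x -> nbd F b x ->
    triv F b y *m h y *m cotriv E a y @[y --> x]
      --> triv F b x *m h x *m cotriv E a x) /\
  (forall t x, tcomp t ->
    lin F t x (act t x) *m h x = h (act t x) *m lin E t x (act t x)).

Definition bundle_iso E F :=
  exists (h : forall x, 'M[C]_(rk F x, rk E x))
         (k : forall x, 'M[C]_(rk E x, rk F x)),
    [/\ bundle_map h, bundle_map k,
        forall x, k x *m h x = 1%:M & forall x, h x *m k x = 1%:M].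

Lemma bundle_map1 E : @bundle_map E E (fun x => 1%:M).
Proof.
split=> [a b x ax bx|t x _]; last by rewrite mulmx1 mul1mx.
by rewrite mulmx1; under eq_fun do rewrite mulmx1; exact: triv_cont.
Qed.

Lemma bundle_map_comp E F G h k :
  @bundle_map E F h -> @bundle_map F G k -> @bundle_map E G (fun x => k x *m h x).
Proof.
move=> [hc he] [kc ke]; split=> [a c x ax cx|t x tc]; last first.
  by rewrite mulmxA ke // -!mulmxA he.
have split_at y : nbd F x y -> triv G c y *m (k y *m h y) *m cotriv E a y =
  (triv G c y *m k y *m cotriv F x y) *m (triv F x y *m h y *m cotriv E a y).
  move=> Fy; rewrite !mulmxA; congr (_ *m _ *m _).
  by rewrite -(mulmxA _ (cotriv F x y)) trivK // mulmx1.
have xx := nbd_self F x.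
rewrite split_at //.
apply: cvg_trans; last exact: (cvg_mulmx (kc x c x xx cx) (hc a x x ax xx)).
apply: near_eq_cvg; near=> y; apply/esym/split_at.
by near: y; apply: open_nbhs_nbhs; split=> //; exact: nbd_open.
Unshelve. all: by end_near. Qed.

Lemma bundle_iso_refl E : bundle_iso E E.
Proof.
exists (fun x => 1%:M), (fun x => 1%:M).
by split; do ?exact: bundle_map1; move=> x; rewrite mulmx1.
Qed.

Lemma bundle_iso_sym E F : bundle_iso E F -> bundle_iso F E.
Proof. by move=> [h [k [hm km kh hk]]]; exists k, h. Qed.

Lemma bundle_iso_trans E F G :
  bundle_iso E F -> bundle_iso F G -> bundle_iso E G.
Proof.
move=> [h [k [hm km kh hk]]] [h' [k' [hm' km' kh' hk']]].
exists (fun x => h' x *m h x), (fun x => k x *m k' x); split.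
- exact: bundle_map_comp hm'.
- exact: bundle_map_comp km.
- by move=> x; rewrite mulmxA -(mulmxA (k x)) kh' mulmx1.
- by move=> x; rewrite mulmxA -(mulmxA (h' x)) hk mulmx1.
Qed.

Section DirectSum.
Variables E F : eqbundle.


Lemma mul_dsummx p q r p' q' r' (A : 'M[C]_(p, q)) (B : 'M[C]_(p', q'))
    (A' : 'M[C]_(q, r)) (B' : 'M[C]_(q', r')) :
  block_mx A 0 0 B *m block_mx A' 0 0 B' = block_mx (A *m A') 0 0 (B *m B').
Proof. by rewrite mulmx_block !mul0mx !mulmx0 !addr0 add0r. Qed.

Program Definition dsum : eqbundle := {|
  rk := fun x => (rk E x + rk F x)%N;
  nbd := fun a => nbd E a `&` nbd F a;
  triv := fun a x => block_mx (triv E a x) 0 0 (triv F a x);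
  cotriv := fun a x => block_mx (cotriv E a x) 0 0 (cotriv F a x);
  lin := fun t x y => block_mx (lin E t x y) 0 0 (lin F t x y) |}.
Next Obligation. by move=> /= a; apply: openI; exact: nbd_open. Qed.
Next Obligation. by move=> a; split; exact: nbd_self. Qed.
Next Obligation. by move=> /= a x [??]; rewrite mul_dsummx !trivK // -scalar_mx_block. Qed.
Next Obligation. by move=> /= a x [??]; rewrite mul_dsummx !cotrivK // -scalar_mx_block. Qed.
Next Obligation.
move=> /= a b x [??] [??]; rewrite mul_dsummx; under eq_fun do rewrite mul_dsummx.
by apply: cvg_dsummx; exact: triv_cont.
Qed.
Next Obligation. by move=> /= x; rewrite !lin1 -scalar_mx_block. Qed.
Next Obligation. by move=> /= s t x y z *; rewrite mul_dsummx -!linM. Qed.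
Next Obligation.
move=> /= a b t x ? [??] [??]; rewrite !mul_dsummx; under eq_fun do rewrite !mul_dsummx.
by apply: cvg_dsummx; exact: lin_cont.
Qed.
End DirectSum.

Section Tensor.
Variables E F : eqbundle.

Lemma tensmx11 p q : (1%:M : 'M[C]_p) *t (1%:M : 'M[C]_q) = 1%:M.
Proof.
apply/matrixP => i j; case: (mxtens_indexP i) => a b.
case: (mxtens_indexP j) => c d; rewrite tensmxE !mxE -natrM mulnb -xpair_eqE.
by rewrite (can_eq (@mxtens_indexK _ _)).
Qed.

Program Definition tens : eqbundle := {|
  rk := fun x => (rk E x * rk F x)%N;
  nbd := fun a => nbd E a `&` nbd F a;
  triv := fun a x => triv E a x *t triv F a x;
  cotriv := fun a x => cotriv E a x *t cotriv F a x;
  lin := fun t x y => lin E t x y *t lin F t x y |}.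
Next Obligation. by move=> /= a; apply: openI; exact: nbd_open. Qed.
Next Obligation. by move=> a; split; exact: nbd_self. Qed.
Next Obligation. by move=> /= a x [??]; rewrite tensmx_mul !trivK // tensmx11. Qed.
Next Obligation. by move=> /= a x [??]; rewrite tensmx_mul !cotrivK // tensmx11. Qed.
Next Obligation.
move=> /= a b x [??] [??]; rewrite tensmx_mul; under eq_fun do rewrite tensmx_mul.
by apply: cvg_tensmx; exact: triv_cont.
Qed.
Next Obligation. by move=> /= x; rewrite !lin1 tensmx11. Qed.
Next Obligation. by move=> /= s t x y z *; rewrite tensmx_mul -!linM. Qed.
Next Obligation.
move=> /= a b t x ? [??] [??]; rewrite !tensmx_mul; under eq_fun do rewrite !tensmx_mul.
by apply: cvg_tensmx; exact: lin_cont.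
Qed.
End Tensor.

Program Definition zerob : eqbundle := {|
  rk := fun=> 0%N;
  nbd := fun=> setT;
  triv := fun _ _ => 0;
  cotriv := fun _ _ => 0;
  lin := fun _ _ _ => 0 |}.
Next Obligation. by move=> a; exact: openT. Qed.
Next Obligation. by []. Qed.
Next Obligation. by move=> *; apply/matrixP; case. Qed.
Next Obligation. by move=> *; apply/matrixP; case. Qed.
Next Obligation. by move=> /= *; exact: cvg_cst. Qed.
Next Obligation. by move=> *; apply/matrixP; case. Qed.
Next Obligation. by move=> *; apply/matrixP; case. Qed.
Next Obligation. by move=> /= *; exact: cvg_cst. Qed.

(* X x C_u, where T_comp acts on C_u through e^u *)
Program Definition lineb (u : 'rV[int]_n) : eqbundle := {|
  rk := fun=> 1%N;
  nbd := fun=> setT;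
  triv := fun _ _ => 1%:M;
  cotriv := fun _ _ => 1%:M;
  lin := fun t _ _ => (chi u t)%:M |}.
Next Obligation. by move=> u a; exact: openT. Qed.
Next Obligation. by []. Qed.
Next Obligation. by move=> *; rewrite mulmx1. Qed.
Next Obligation. by move=> *; rewrite mulmx1. Qed.
Next Obligation. by move=> *; exact: cvg_cst. Qed.
Next Obligation. by move=> /= *; rewrite chi1. Qed.
Next Obligation. by move=> /= *; rewrite chiM scalar_mxM. Qed.
Next Obligation.
move=> /= u _ _ t x _ _ _.
rewrite mul1mx mulmx1; under eq_fun do rewrite mul1mx mulmx1.
apply: cvg_mx => i j; rewrite !ord1 mxE; under eq_fun do rewrite mxE.
rewrite /= !mulr1n; under eq_fun do rewrite mulr1n.
apply: cvg_within_filter.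
apply: (@cvg_comp _ _ _ (@fst (torus C n) X) (chi u) _ (nbhs t)).
  exact: cvg_fst.
exact: chi_continuous.
Qed.
End Bundles.

Section Laws.
Variables (C : numFieldType) (n : nat) (X : topologicalType).
Variable act : torus C n -> X -> X.
Local Notation eqbundle := (eqbundle act).
Implicit Types E F G : eqbundle.

Lemma mul_colsub_rowsub p q r s (c : 'I_s -> 'I_q) (b : 'I_q -> 'I_s)
    (A : 'M[C]_(p, q)) (B : 'M[C]_(q, r)) :
  cancel c b -> cancel b c -> colsub c A *m rowsub c B = A *m B.
Proof.
move=> cb bc; apply/matrixP => i j; rewrite !mxE.
rewrite [RHS](reindex c) /=; last by exists b => x _.
by apply: eq_bigr => k _; rewrite !mxE.
Qed.

Lemma rowsub_cvg p q r (T : Type) (Fl : set_system T) {FF : Filter Fl}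
    (c : 'I_p -> 'I_q) (f : T -> 'M[C]_(q, r)) (A : 'M[C]_(q, r)) :
  f @ Fl --> A -> rowsub c (f x) @[x --> Fl] --> rowsub c A.
Proof.
move=> fA; apply: cvg_mx => i j; rewrite mxE; under eq_fun do rewrite mxE.
exact: cvg_mxE.
Qed.

(* permuting the chosen bases of the fibres *)
Lemma bundle_iso_reindex E F
  (c : forall x, 'I_(rk F x) -> 'I_(rk E x))
  (b : forall x, 'I_(rk E x) -> 'I_(rk F x)) :
  (forall x, cancel (c x) (b x)) -> (forall x, cancel (b x) (c x)) ->
  (forall a x, nbd F a x <-> nbd E a x) ->
  (forall a x i j, triv F a x i j = triv E a x (c a i) (c x j)) ->
  (forall a x i j, cotriv F a x i j = cotriv E a x (c x i) (c a j)) ->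
  (forall t x y i j, lin F t x y i j = lin E t x y (c y i) (c x j)) ->
  bundle_iso E F.
Proof.
move=> cb bc eN eT eV eL.
have {}eT a x : triv F a x = rowsub (c a) (colsub (c x) (triv E a x)).
  by apply/matrixP => i j; rewrite eT !mxE.
have {}eV a x : cotriv F a x = rowsub (c x) (colsub (c a) (cotriv E a x)).
  by apply/matrixP => i j; rewrite eV !mxE.
have {}eL t x y : lin F t x y = rowsub (c y) (colsub (c x) (lin E t x y)).
  by apply/matrixP => i j; rewrite eL !mxE.
pose h x : 'M[C]_(rk F x, rk E x) := rowsub (c x) 1%:M.
pose k x : 'M[C]_(rk E x, rk F x) := colsub (c x) 1%:M.
have kh x : k x *m h x = 1%:M.
  by rewrite (mul_colsub_rowsub _ _ (cb x) (bc x)) mulmx1.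
have hk x : h x *m k x = 1%:M.
  rewrite mul_rowsub_mx mul1mx; apply/matrixP => i j; rewrite !mxE.
  by rewrite (inj_eq (can_inj (cb x))).
have Th a x : triv F a x *m h x = h a *m triv E a x.
  rewrite eT mul_rowsub_mx (mul_colsub_rowsub _ _ (cb x) (bc x)) mulmx1.
  by rewrite mul_rowsub_mx mul1mx.
have kV a x : k x *m cotriv F a x = cotriv E a x *m k a.
  rewrite eV (mul_colsub_rowsub _ _ (cb x) (bc x)) mul1mx.
  by rewrite mulmx_colsub mulmx1.
exists h, k; split => //; split.
- move=> a a' x Ea /eN Ea'; rewrite Th -mulmxA.
  under eq_fun do rewrite Th -mulmxA.
  by apply: cvg_mulmx; [exact: cvg_cst|exact: triv_cont].
- move=> t x tc; rewrite eL mul_rowsub_mx.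
  rewrite (mul_colsub_rowsub _ _ (cb x) (bc x)) mulmx1.
  by rewrite mul_rowsub_mx mul1mx.
- move=> a a' x /eN Ea Ea'; rewrite -mulmxA kV mulmxA.
  under eq_fun do rewrite -mulmxA kV mulmxA.
  by apply: cvg_mulmx; [exact: triv_cont|exact: cvg_cst].
- move=> t x tc; rewrite eL.
  rewrite (mul_colsub_rowsub _ _ (cb _) (bc _)) mul1mx.
  by rewrite mulmx_colsub mulmx1.
Qed.

Lemma dsum_iso E E' F F' :
  bundle_iso E E' -> bundle_iso F F' -> bundle_iso (dsum E F) (dsum E' F').
Proof.
move=> [h [k [[hc he] [kc ke] kh hk]]] [h' [k' [[hc' he'] [kc' ke'] kh' hk']]].
exists (fun x => block_mx (h x) 0 0 (h' x)),
       (fun x => block_mx (k x) 0 0 (k' x)).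
split; try (split=> /=).
- move=> a b x [Ea Fa] [Eb Fb]; rewrite !mul_dsummx.
  under eq_fun do rewrite !mul_dsummx.
  by apply: cvg_dsummx; [exact: hc|exact: hc'].
- by move=> t x tc; rewrite !mul_dsummx he // he'.
- move=> a b x [Ea Fa] [Eb Fb]; rewrite !mul_dsummx.
  under eq_fun do rewrite !mul_dsummx.
  by apply: cvg_dsummx; [exact: kc|exact: kc'].
- by move=> t x tc; rewrite !mul_dsummx ke // ke'.
- by move=> x; rewrite mul_dsummx kh kh' -scalar_mx_block.
- by move=> x; rewrite mul_dsummx hk hk' -scalar_mx_block.
Qed.

Lemma tens_iso E E' F F' :
  bundle_iso E E' -> bundle_iso F F' -> bundle_iso (tens E F) (tens E' F').
Proof.
move=> [h [k [[hc he] [kc ke] kh hk]]] [h' [k' [[hc' he'] [kc' ke'] kh' hk']]].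
exists (fun x => h x *t h' x), (fun x => k x *t k' x).
split; try (split=> /=).
- move=> a b x [Ea Fa] [Eb Fb]; rewrite !tensmx_mul.
  under eq_fun do rewrite !tensmx_mul.
  by apply: cvg_tensmx; [exact: hc|exact: hc'].
- by move=> t x tc; rewrite !tensmx_mul he // he'.
- move=> a b x [Ea Fa] [Eb Fb]; rewrite !tensmx_mul.
  under eq_fun do rewrite !tensmx_mul.
  by apply: cvg_tensmx; [exact: kc|exact: kc'].
- by move=> t x tc; rewrite !tensmx_mul ke // ke'.
- by move=> x; rewrite tensmx_mul kh kh' tensmx11.
- by move=> x; rewrite tensmx_mul hk hk' tensmx11.
Qed.

Definition dsum_entry p q r s (A : 'M[C]_(p, q)) (B : 'M[C]_(r, s))
    (i : 'I_p + 'I_r) (j : 'I_q + 'I_s) : C :=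
  match i, j with
  | inl a, inl b => A a b
  | inr a, inr b => B a b
  | _, _ => 0
  end.

Lemma dsummxE p q r s (A : 'M[C]_(p, q)) (B : 'M[C]_(r, s)) i j :
  (block_mx A 0 0 B) i j = dsum_entry A B (fintype.split i) (fintype.split j).
Proof.
rewrite -[in LHS](splitK i) -[in LHS](splitK j).
case: (fintype.split i) => a; case: (fintype.split j) => b /=.
- exact: block_mxEul.
- by rewrite block_mxEur mxE.
- by rewrite block_mxEdl mxE.
- exact: block_mxEdr.
Qed.

Lemma tensmxE' p q r s (A : 'M[C]_(p, q)) (B : 'M[C]_(r, s)) i j :
  (A *t B) i j = A (mxtens_unindex i).1 (mxtens_unindex j).1 *
                 B (mxtens_unindex i).2 (mxtens_unindex j).2.
Proof. by rewrite mxE. Qed.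

Definition sumC p q (i : 'I_(p + q)) : 'I_(q + p) :=
  unsplit (match fintype.split i with inl a => inr a | inr b => inl b end).

Lemma sumCK p q : cancel (@sumC p q) (@sumC q p).
Proof.
move=> i; rewrite /sumC unsplitK -[RHS]splitK.
by case: (fintype.split i).
Qed.

Lemma dsumC E F : bundle_iso (dsum E F) (dsum F E).
Proof.
apply: (@bundle_iso_reindex (dsum E F) (dsum F E)
  (fun x => @sumC _ _) (fun x => @sumC _ _)) => /=.
- by move=> x; exact: sumCK.
- by move=> x; exact: sumCK.
- by move=> a x; split=> -[].
- move=> a x i j; rewrite !dsummxE /sumC !unsplitK.
  by case: (fintype.split i) => ?; case: (fintype.split j) => ?.
- move=> a x i j; rewrite !dsummxE /sumC !unsplitK.
  by case: (fintype.split i) => ?; case: (fintype.split j) => ?.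
- move=> t x y i j; rewrite !dsummxE /sumC !unsplitK.
  by case: (fintype.split i) => ?; case: (fintype.split j) => ?.
Qed.

Definition sumA p q r (i : 'I_((p + q) + r)) : 'I_(p + (q + r)) :=
  unsplit (match fintype.split i with
           | inl c => match fintype.split c with
                      | inl a => inl a
                      | inr b => inr (unsplit (inl b))
                      end
           | inr d => inr (unsplit (inr d))
           end).
Definition sumA' p q r (i : 'I_(p + (q + r))) : 'I_((p + q) + r) :=
  unsplit (match fintype.split i with
           | inl a => inl (unsplit (inl a))
           | inr c => match fintype.split c with
                      | inl b => inl (unsplit (inr b))
                      | inr d => inr d
                      end
           end).

Lemma sumAK p q r : cancel (@sumA p q r) (@sumA' p q r).
Proof.
move=> i; rewrite /sumA /sumA' unsplitK -[RHS]splitK.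
case: (fintype.split i) => [c|d]; last by rewrite unsplitK.
by rewrite -[in RHS](splitK c); case: (fintype.split c) => a; rewrite ?unsplitK.
Qed.

Lemma sumA'K p q r : cancel (@sumA' p q r) (@sumA p q r).
Proof.
move=> i; rewrite /sumA /sumA' unsplitK -[RHS]splitK.
case: (fintype.split i) => [c|d]; first by rewrite unsplitK.
by rewrite -[in RHS](splitK d); case: (fintype.split d) => a; rewrite ?unsplitK.
Qed.

Lemma dsumA E F G : bundle_iso (dsum E (dsum F G)) (dsum (dsum E F) G).
Proof.
apply: (@bundle_iso_reindex (dsum E (dsum F G)) (dsum (dsum E F) G)
  (fun x => @sumA _ _ _) (fun x => @sumA' _ _ _)) => /=.
- by move=> x; exact: sumAK.
- by move=> x; exact: sumA'K.
- by move=> a x; split=> [[[]]|[? []]].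
- move=> a x i j; rewrite !dsummxE /sumA !unsplitK.
  case: (fintype.split i) => [i'|?]; case: (fintype.split j) => [j'|?];
  rewrite /dsum_entry ?dsummxE ?unsplitK //;
  try (case: (fintype.split i') => ?); try (case: (fintype.split j') => ?);
  by rewrite /dsum_entry ?dsummxE ?unsplitK.
- move=> a x i j; rewrite !dsummxE /sumA !unsplitK.
  case: (fintype.split i) => [i'|?]; case: (fintype.split j) => [j'|?];
  rewrite /dsum_entry ?dsummxE ?unsplitK //;
  try (case: (fintype.split i') => ?); try (case: (fintype.split j') => ?);
  by rewrite /dsum_entry ?dsummxE ?unsplitK.
- move=> t x y i j; rewrite !dsummxE /sumA !unsplitK.
  case: (fintype.split i) => [i'|?]; case: (fintype.split j) => [j'|?];
  rewrite /dsum_entry ?dsummxE ?unsplitK //;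
  try (case: (fintype.split i') => ?); try (case: (fintype.split j') => ?);
  by rewrite /dsum_entry ?dsummxE ?unsplitK.
Qed.

Definition sum0 p (i : 'I_p) : 'I_(0 + p) := unsplit (inr i).
Definition sum0' p (i : 'I_(0 + p)) : 'I_p := i.

Lemma sum0K p : cancel (@sum0 p) (@sum0' p).
Proof. by move=> i; apply: val_inj. Qed.

Lemma sum0'K p : cancel (@sum0' p) (@sum0 p).
Proof. by move=> i; apply: val_inj. Qed.

Lemma dsum0 E : bundle_iso (dsum (zerob act) E) E.
Proof.
apply: (@bundle_iso_reindex (dsum (zerob act) E) E
  (fun x => @sum0 _) (fun x => @sum0' _)) => /=.
- by move=> x; exact: sum0K.
- by move=> x; exact: sum0'K.
- by move=> a x; split=> [|[]].
- by move=> a x i j; rewrite dsummxE !unsplitK.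
- by move=> a x i j; rewrite dsummxE !unsplitK.
- by move=> t x y i j; rewrite dsummxE !unsplitK.
Qed.

Definition prodC p q (i : 'I_(p * q)) : 'I_(q * p) :=
  mxtens_index ((mxtens_unindex i).2, (mxtens_unindex i).1).

Lemma prodCK p q : cancel (@prodC p q) (@prodC q p).
Proof.
by move=> i; rewrite /prodC mxtens_indexK -surjective_pairing mxtens_unindexK.
Qed.

Lemma tensC E F : bundle_iso (tens E F) (tens F E).
Proof.
apply: (@bundle_iso_reindex (tens E F) (tens F E)
  (fun x => @prodC _ _) (fun x => @prodC _ _)) => /=.
- by move=> x; exact: prodCK.
- by move=> x; exact: prodCK.
- by move=> a x; split=> -[].
- by move=> a x i j; rewrite !tensmxE' /prodC !mxtens_indexK mulrC.
- by move=> a x i j; rewrite !tensmxE' /prodC !mxtens_indexK mulrC.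
- by move=> t x y i j; rewrite !tensmxE' /prodC !mxtens_indexK mulrC.
Qed.

Definition prodA p q r (i : 'I_((p * q) * r)) : 'I_(p * (q * r)) :=
  let u := mxtens_unindex i in let v := mxtens_unindex u.1 in
  mxtens_index (v.1, mxtens_index (v.2, u.2)).
Definition prodA' p q r (i : 'I_(p * (q * r))) : 'I_((p * q) * r) :=
  let u := mxtens_unindex i in let v := mxtens_unindex u.2 in
  mxtens_index (mxtens_index (u.1, v.1), v.2).

Lemma prodAE p q r (a : 'I_p) (b : 'I_q) (d : 'I_r) :
  prodA (mxtens_index (mxtens_index (a, b), d)) =
  mxtens_index (a, mxtens_index (b, d)).
Proof. by rewrite /prodA !mxtens_indexK; cbn [fst snd]; rewrite ?mxtens_indexK. Qed.

Lemma prodA'E p q r (a : 'I_p) (b : 'I_q) (d : 'I_r) :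
  prodA' (mxtens_index (a, mxtens_index (b, d))) =
  mxtens_index (mxtens_index (a, b), d).
Proof. by rewrite /prodA' !mxtens_indexK; cbn [fst snd]; rewrite ?mxtens_indexK. Qed.

Lemma prodAK p q r : cancel (@prodA p q r) (@prodA' p q r).
Proof.
move=> i; case: (mxtens_indexP i) => c d; case: (mxtens_indexP c) => a b.
by rewrite prodAE prodA'E.
Qed.

Lemma prodA'K p q r : cancel (@prodA' p q r) (@prodA p q r).
Proof.
move=> i; case: (mxtens_indexP i) => a c; case: (mxtens_indexP c) => b d.
by rewrite prodA'E prodAE.
Qed.

Lemma tensA E F G : bundle_iso (tens E (tens F G)) (tens (tens E F) G).
Proof.
apply: (@bundle_iso_reindex (tens E (tens F G)) (tens (tens E F) G)
  (fun x => @prodA _ _ _) (fun x => @prodA' _ _ _)) => /=.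
- by move=> x; exact: prodAK.
- by move=> x; exact: prodA'K.
- by move=> a x; split=> [[[]]|[? []]].
- move=> a x i j; case: (mxtens_indexP i) => i1 i3; case: (mxtens_indexP i1) => i1' i2.
  case: (mxtens_indexP j) => j1 j3; case: (mxtens_indexP j1) => j1' j2.
  by rewrite !prodAE !tensmxE mulrA.
- move=> a x i j; case: (mxtens_indexP i) => i1 i3; case: (mxtens_indexP i1) => i1' i2.
  case: (mxtens_indexP j) => j1 j3; case: (mxtens_indexP j1) => j1' j2.
  by rewrite !prodAE !tensmxE mulrA.
- move=> t x y i j; case: (mxtens_indexP i) => i1 i3; case: (mxtens_indexP i1) => i1' i2.
  case: (mxtens_indexP j) => j1 j3; case: (mxtens_indexP j1) => j1' j2.
  by rewrite !prodAE !tensmxE mulrA.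
Qed.

Definition prod1 p (i : 'I_p) : 'I_(1 * p) := mxtens_index (ord0, i).
Definition prod1' p (i : 'I_(1 * p)) : 'I_p := (mxtens_unindex i).2.

Lemma prod1K p : cancel (@prod1 p) (@prod1' p).
Proof. by move=> i; rewrite /prod1 /prod1' mxtens_indexK. Qed.

Lemma prod1'K p : cancel (@prod1' p) (@prod1 p).
Proof.
move=> i; rewrite /prod1 /prod1' -[RHS]mxtens_unindexK.
by case: (mxtens_unindex i) => a b; rewrite (ord1 a).
Qed.

Lemma tens1 E : bundle_iso (tens (lineb act 0) E) E.
Proof.
apply: (@bundle_iso_reindex (tens (lineb act 0) E) E
  (fun x => @prod1 _) (fun x => @prod1' _)) => /=.
- by move=> x; exact: prod1K.
- by move=> x; exact: prod1'K.
- by move=> a x; split=> [|[]].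
- by move=> a x i j; rewrite tensmxE' !mxtens_indexK /= mxE mul1r.
- by move=> a x i j; rewrite tensmxE' !mxtens_indexK /= mxE mul1r.
- by move=> t x y i j; rewrite tensmxE' !mxtens_indexK /= mxE chi0 mul1r.
Qed.

Lemma rank0_iso E : (forall x, rk E x = 0%N) -> bundle_iso E (zerob act).
Proof.
move=> E0; have no x (i : 'I_(rk E x)) : False.
  by have := ltn_ord i; rewrite [X in (_ < X)%N]E0.
exists (fun=> 0), (fun=> 0); split; try split.
- by move=> a b x _ _; apply: cvg_mx => -[].
- by move=> t x _; apply/matrixP => -[].
- by move=> a b x _ _; apply: cvg_mx => i [].
- by move=> t x _; apply/matrixP => i [].
- by move=> x; apply/matrixP => i; case: (no _ i).
- by move=> x; apply/matrixP => -[].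
Qed.

Lemma tens0 E : bundle_iso (tens (zerob act) E) (zerob act).
Proof. exact: rank0_iso. Qed.

Definition sumprod p q r (i : 'I_(p * r + q * r)) : 'I_((p + q) * r) :=
  match fintype.split i with
  | inl u => let v := mxtens_unindex u in mxtens_index (unsplit (inl v.1), v.2)
  | inr u => let v := mxtens_unindex u in mxtens_index (unsplit (inr v.1), v.2)
  end.
Definition sumprod' p q r (i : 'I_((p + q) * r)) : 'I_(p * r + q * r) :=
  let v := mxtens_unindex i in
  unsplit (match fintype.split v.1 with
           | inl a => inl (mxtens_index (a, v.2))
           | inr b => inr (mxtens_index (b, v.2))
           end).

Lemma sumprodK p q r : cancel (@sumprod p q r) (@sumprod' p q r).
Proof.
move=> i; rewrite /sumprod /sumprod' -[RHS]splitK.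
case: (fintype.split i) => u; case: (mxtens_indexP u) => a b.
  by rewrite !mxtens_indexK; cbn [fst snd]; rewrite unsplitK.
by rewrite !mxtens_indexK; cbn [fst snd]; rewrite unsplitK.
Qed.

Lemma sumprod'K p q r : cancel (@sumprod' p q r) (@sumprod p q r).
Proof.
move=> i; case: (mxtens_indexP i) => c d.
rewrite /sumprod /sumprod' unsplitK mxtens_indexK; cbn [fst snd].
rewrite -[in RHS](splitK c); case: (fintype.split c) => a.
  by rewrite mxtens_indexK.
by rewrite mxtens_indexK.
Qed.

Lemma tensDl E F G :
  bundle_iso (tens (dsum E F) G) (dsum (tens E G) (tens F G)).
Proof.
apply: (@bundle_iso_reindex (tens (dsum E F) G) (dsum (tens E G) (tens F G))
  (fun x => @sumprod _ _ _) (fun x => @sumprod' _ _ _)) => /=.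
- by move=> x; exact: sumprodK.
- by move=> x; exact: sumprod'K.
- by move=> a x; split=> [[[? ?] [? ?]]|[[? ?] ?]].
- move=> a x i j; rewrite !dsummxE tensmxE' /sumprod.
  case: (fintype.split i) => u; case: (fintype.split j) => v;
  case: (mxtens_indexP u) => ? ?; case: (mxtens_indexP v) => ? ?;
  rewrite !mxtens_indexK; cbn [fst snd dsum_entry];
  by rewrite dsummxE !unsplitK ?tensmxE ?mul0r.
- move=> a x i j; rewrite !dsummxE tensmxE' /sumprod.
  case: (fintype.split i) => u; case: (fintype.split j) => v;
  case: (mxtens_indexP u) => ? ?; case: (mxtens_indexP v) => ? ?;
  rewrite !mxtens_indexK; cbn [fst snd dsum_entry];
  by rewrite dsummxE !unsplitK ?tensmxE ?mul0r.
- move=> t x y i j; rewrite !dsummxE tensmxE' /sumprod.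
  case: (fintype.split i) => u; case: (fintype.split j) => v;
  case: (mxtens_indexP u) => ? ?; case: (mxtens_indexP v) => ? ?;
  rewrite !mxtens_indexK; cbn [fst snd dsum_entry];
  by rewrite dsummxE !unsplitK ?tensmxE ?mul0r.
Qed.
End Laws.

Section KTheory.
Variables (C : numFieldType) (n : nat) (X : topologicalType).
Variable act : torus C n -> X -> X.
Implicit Types E F : eqbundle act.

HB.instance Definition _ := gen_eqMixin (eqbundle act).
HB.instance Definition _ := gen_choiceMixin (eqbundle act).

Definition iso_rel E F : bool := `[< bundle_iso E F >].

Lemma iso_rel_refl : reflexive iso_rel.
Proof. by move=> E; apply/asboolP/bundle_iso_refl. Qed.

Lemma iso_rel_sym : symmetric iso_rel.
Proof. by move=> E F; apply/asboolP/asboolP; exact: bundle_iso_sym. Qed.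

Lemma iso_rel_trans : transitive iso_rel.
Proof.
move=> F E G /asboolP EF /asboolP FG; apply/asboolP.
exact: bundle_iso_trans EF FG.
Qed.

Canonical iso_equiv :=
  EquivRel iso_rel iso_rel_refl iso_rel_sym iso_rel_trans.

Definition vect := {eq_quot iso_equiv}.
HB.instance Definition _ := Choice.on vect.

Definition vclass E : vect := \pi E.
Definition vrepr (v : vect) : eqbundle act := repr v.

Lemma vclassP E F : bundle_iso E F <-> vclass E = vclass F.
Proof. by split=> [e|/eqquotP /asboolP //]; exact/eqquotP/asboolP. Qed.

Lemma vreprK v : vclass (vrepr v) = v.
Proof. exact: reprK. Qed.

Lemma vrepr_iso E : bundle_iso (vrepr (vclass E)) E.
Proof. by apply/vclassP; rewrite vreprK. Qed.

Definition vadd (v w : vect) : vect := vclass (dsum (vrepr v) (vrepr w)).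
Definition vmul (v w : vect) : vect := vclass (tens (vrepr v) (vrepr w)).

Lemma vclassD E F : vadd (vclass E) (vclass F) = vclass (dsum E F).
Proof. by apply/vclassP; apply: dsum_iso; exact: vrepr_iso. Qed.

Lemma vclassM E F : vmul (vclass E) (vclass F) = vclass (tens E F).
Proof. by apply/vclassP; apply: tens_iso; exact: vrepr_iso. Qed.

Lemma vaddA : associative vadd.
Proof.
move=> u v w; rewrite -[u]vreprK -[v]vreprK -[w]vreprK !vclassD.
by apply/vclassP; exact: dsumA.
Qed.

Lemma vaddC : commutative vadd.
Proof.
move=> u v; rewrite -[u]vreprK -[v]vreprK !vclassD.
by apply/vclassP; exact: dsumC.
Qed.

Lemma vadd0 : left_id (vclass (zerob act)) vadd.
Proof.
by move=> u; rewrite -[u]vreprK !vclassD; apply/vclassP; exact: dsum0.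
Qed.

HB.instance Definition _ := GRing.isNmodule.Build vect vaddA vaddC vadd0.

Lemma vmulA : associative vmul.
Proof.
move=> u v w; rewrite -[u]vreprK -[v]vreprK -[w]vreprK !vclassM.
by apply/vclassP; exact: tensA.
Qed.

Lemma vmulC : commutative vmul.
Proof.
move=> u v; rewrite -[u]vreprK -[v]vreprK !vclassM.
by apply/vclassP; exact: tensC.
Qed.

Lemma vmul1 : left_id (vclass (lineb act 0)) vmul.
Proof.
by move=> u; rewrite -[u]vreprK !vclassM; apply/vclassP; exact: tens1.
Qed.

Lemma vmulDl : left_distributive vmul vadd.
Proof.
move=> u v w; rewrite -[u]vreprK -[v]vreprK -[w]vreprK.
rewrite vclassD !vclassM vclassD.
by apply/vclassP; exact: tensDl.
Qed.

Lemma vmul0 : left_zero (vclass (zerob act)) vmul.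
Proof.
by move=> u; rewrite -[u]vreprK !vclassM; apply/vclassP; exact: tens0.
Qed.

HB.instance Definition _ := GRing.Nmodule_isComPzSemiRing.Build vect
  vmulA vmulC vmul1 vmulDl vmul0.

Definition K0 := groth vect.
HB.instance Definition _ := GRing.ComPzRing.on K0.

Definition kclass E : K0 := gclass (vclass E).

Lemma tens_line u v :
  bundle_iso (tens (lineb act u) (lineb act v)) (lineb act (u + v)).
Proof.
apply: (@bundle_iso_reindex _ _ _ _ (tens (lineb act u) (lineb act v))
  (lineb act (u + v)) (fun x => @prod1 _) (fun x => @prod1' _)) => /=.
- by move=> x; exact: prod1K.
- by move=> x; exact: prod1'K.
- by move=> a x; split=> [|[]].
- by move=> a x i j; rewrite tensmxE' !mxtens_indexK /= !mxE mul1r.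
- by move=> a x i j; rewrite tensmxE' !mxtens_indexK /= !mxE mul1r.
- move=> t x y i j; rewrite tensmxE' !mxtens_indexK /= !mxE chiD !ord1.
  by rewrite !mulr1n.
Qed.

Lemma kclass_line u v :
  kclass (lineb act (u + v)) = kclass (lineb act u) * kclass (lineb act v).
Proof.
rewrite -[RHS]gclassM; congr gclass; apply/esym.
by rewrite [_ * _]vclassM; apply/vclassP; exact: tens_line.
Qed.

(* the structure map R(T_comp) = Z[M] -> K^0(X), which sends e^u to [X x C_u] *)
Definition kscalar (a : charring n) : K0 :=
  \sum_(u <- suppc a) kclass (lineb act u) *~ coefc a u.

Lemma kscalarw (d : {fset 'rV[int]_n}) a : (suppc a `<=` d)%fset ->
  kscalar a = \sum_(u <- d) kclass (lineb act u) *~ coefc a u.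
Proof.
move=> le; rewrite /kscalar (big_fset_incl _ le) //= => u _ /coefc_out ->.
exact: mulr0z.
Qed.

Lemma kscalarD a b : kscalar (a + b) = kscalar a + kscalar b.
Proof.
have leD : (suppc (a + b)%R `<=` suppc a `|` suppc b)%fset.
  exact: msuppD_le.
rewrite (kscalarw leD) (kscalarw (fsubsetUl (suppc a) (suppc b))).
rewrite (kscalarw (fsubsetUr (suppc a) (suppc b))) -big_split /=.
apply: eq_bigr => u _; rewrite -mulrzDr; congr (_ *~ _).
exact: mcoeffD.
Qed.

Lemma kscalar0 : kscalar 0 = 0.
Proof. by rewrite /kscalar /suppc msupp0 big_seq_fset0. Qed.

Lemma kscalarU u c : kscalar (mkmalgU u c) = kclass (lineb act u) *~ c.
Proof.
rewrite (kscalarw (d := [fset u]%fset)) ?big_seq_fset1.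
  by rewrite /coefc mcoeffUU.
exact: msuppU_le.
Qed.

Lemma kscalar_sum I (r : seq I) (P : I -> charring n) :
  kscalar (\sum_(i <- r) P i) = \sum_(i <- r) kscalar (P i).
Proof. exact: (big_morph kscalar kscalarD kscalar0). Qed.

Lemma kscalarM a b : kscalar (a * b) = kscalar a * kscalar b.
Proof.
rewrite [a * b]/(mulc a b) kscalar_sum mulr_suml; apply: eq_bigr => u _.
rewrite kscalar_sum mulr_sumr; apply: eq_bigr => v _.
by rewrite kscalarU kclass_line mulrzAl mulrzAr -mulrzA [(coefc b v * _)%R]mulrC.
Qed.

Lemma kscalar1 : kscalar 1 = 1.
Proof. exact: kscalarU. Qed.

Definition kscale (a : charring n) (x : K0) : K0 := kscalar a * x.

Lemma kscaleA a b x : kscale a (kscale b x) = kscale (a * b) x.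
Proof. by rewrite /kscale kscalarM mulrA. Qed.

Lemma kscale1 : left_id 1 kscale.
Proof. by move=> x; rewrite /kscale kscalar1 mul1r. Qed.

Lemma kscaleDr : right_distributive kscale +%R.
Proof. by move=> a x y; rewrite /kscale mulrDr. Qed.

Lemma kscaleDl x : {morph kscale^~ x : a b / a + b}.
Proof. by move=> a b; rewrite /kscale kscalarD mulrDl. Qed.

HB.instance Definition _ := GRing.Zmodule_isLmodule.Build (charring n) K0
  kscaleA kscale1 kscaleDr kscaleDl.
End KTheory.

Section Restriction.
Variables (C : numFieldType) (n : nat) (X : topologicalType).
Variable act : torus C n -> X -> X.

(* At a fixed point x, the fibre E_x is a representation of T_comp; wdim E x u
   is the dimension of its weight space of weight u, computed as the largest
   number of linearly independent weight vectors (the columns of A). *)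
Definition wdim (E : eqbundle act) (x : X) (u : 'rV[int]_n) : nat :=
  \max_(r < (rk E x).+1 |
      `[< exists2 A : 'M[C]_(rk E x, r), \rank A = r &
          forall t, tcomp t -> lin E t x x *m A = chi u t *: A >]) r.

(* the class of E_x in R(T_comp) = Z[M]; only finitely many weights occur *)
Definition fibre_char (E : eqbundle act) (x : X) : charring n :=
  \sum_(u \in [set: 'rV[int]_n]) expc u *+ wdim E x u.

(* f|_x in K^0_(T_comp)(x) = R(T_comp), at a fixed point x: if f = [E] - [F]
   then f|_x = [E_x] - [F_x] *)
Definition krestr (x : X) (f : K0 act) : charring n :=
  let: (v, w) := repr f in fibre_char (vrepr v) x - fibre_char (vrepr w) x.
End Restriction.

Section Varieties.
Variable C : numFieldType.

(* the C-algebra of functions generated by G *)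
Inductive algspan (T : Type) (G : set (T -> C)) : (T -> C) -> Prop :=
| algspan_gen g : G g -> algspan G g
| algspan_cst c : algspan G (fun=> c)
| algspan_add f g : algspan G f -> algspan G g -> algspan G (fun x => f x + g x)
| algspan_mul f g : algspan G f -> algspan G g -> algspan G (fun x => f x * g x).

(* A set covered by charts dom i, each with its ring coord i of coordinate
   functions. A coordinate function is a function on all of pts of which only
   the restriction to dom i matters. Regular functions on the other open sets
   are obtained by localization. *)
Record space := Space {
  pts : Type;
  idx : Type;
  dom : idx -> set pts;
  coord : idx -> set (pts -> C) }.

Implicit Types V W : space.

Definition zclosed V (Z : set (pts V)) :=
  forall i : idx V, exists2 A : set (pts V -> C), A `<=` coord i &
    forall p, dom i p -> (Z p <-> forall a, A a -> a p = 0).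

(* regular functions on a locally closed subset Y *)
Definition regular V (Y : set (pts V)) (g : pts V -> C) :=
  forall p, Y p -> exists (i : idx V) (a b : pts V -> C),
    [/\ dom i p, coord i a, coord i b, b p != 0 &
        forall q, Y q -> dom i q -> b q != 0 -> g q = a q / b q].

Definition zmorphism V W (Y : set (pts V)) (Y' : set (pts W))
    (phi : pts V -> pts W) :=
  [/\ forall p, Y p -> Y' (phi p),
      forall Z', zclosed Z' -> exists2 Z : set (pts V), zclosed Z &
        forall p, Y p -> (Z p <-> Z' (phi p))
    & forall (O : set (pts W)) (g : pts W -> C),
        zclosed (~` O) -> regular (Y' `&` O) g ->
        regular (Y `&` phi @^-1` O) (g \o phi)].

Definition affine_space (k : nat) : space := {|
  pts := 'cV[C]_k;
  idx := unit;
  dom := fun=> setT;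
  coord := fun=> algspan (range (fun (i : 'I_k) (z : 'cV[C]_k) => z i 0)) |}.

Definition prod_space V W : space := {|
  pts := pts V * pts W;
  idx := idx V * idx W;
  dom := fun ij => dom ij.1 `*` dom ij.2;
  coord := fun ij => algspan
    ([set a \o fst | a in coord ij.1] `|` [set b \o snd | b in coord ij.2]) |}.

(* coord i identifies dom i with a Zariski closed subset of some C^k, with its
   ring of polynomial functions *)
Definition affine_chart V (i : idx V) :=
  exists (k : nat) (c : 'I_k -> pts V -> C),
    [/\ forall a : pts V -> C, coord i a <->
          exists2 g, algspan (range c) g & forall p, dom i p -> a p = g p,
        forall p q, dom i p -> dom i q -> (forall j, c j p = c j q) -> p = q
      & @zclosed (affine_space k)
          [set z | exists2 p, dom i p & forall j, z j 0 = c j p]].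

(* separated, of finite type and reduced over C *)
Definition variety V :=
  [/\ finite_set [set: idx V],
      forall p : pts V, exists i : idx V, dom i p,
      (forall i : idx V, affine_chart i /\ zclosed (~` dom i)),
      (forall (i j : idx V) (a : pts V -> C) p,
        coord i a -> dom i p -> dom j p -> exists b c : pts V -> C,
        [/\ coord j b, coord j c, c p != 0 &
          forall q, dom i q -> dom j q -> c q != 0 -> a q = b q / c q])
    & @zclosed (prod_space V V) [set pq | pq.1 = pq.2]].

(* universally closed over a point *)
Definition complete_variety V := forall W, variety W ->
  forall Z : set (pts V * pts W), @zclosed (prod_space V W) Z ->
    zclosed (snd @` Z).

(* The topology put on pts V is the classical one: dom i is open, and carries
   the coarsest topology making all functions in coord i continuous. *)
HB.instance Definition _ V := gen_eqMixin (pts V).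
HB.instance Definition _ V := gen_choiceMixin (pts V).
HB.instance Definition _ V := @isSubBaseTopological.Build (pts V)
  (set (pts V))
  [set B | exists (i : idx V) (a : pts V -> C) (O : set C),
    [/\ coord i a, open O & B = dom i `&` a @^-1` O]] id.
End Varieties.

Section Toric.
Variables (R : realFieldType) (n : nat).
Local Notation NR := 'rV[R]_n.
Local Notation M := 'rV[int]_n.
Implicit Types (sigma tau : set NR) (D : set (set NR)).

Definition pairing (w v : NR) : R := \sum_i w 0 i * v 0 i.

Definition rational_polyhedral sigma :=
  exists (k : nat) (g : 'I_k -> 'rV[int]_n),
    sigma = [set v | exists2 c : 'I_k -> R, forall i, 0 <= c i &
                     v = \sum_i c i *: map_mx intr (g i)].

Definition strongly_convex sigma := forall v, sigma v -> sigma (- v) -> v = 0.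

Definition face tau sigma := exists2 w : NR,
  forall v, sigma v -> 0 <= pairing w v &
  tau = [set v | sigma v /\ pairing w v = 0].

Definition fan D :=
  [/\ finite_set D, D !=set0,
      forall sigma, D sigma -> rational_polyhedral sigma /\ strongly_convex sigma,
      forall sigma tau, D sigma -> face tau sigma -> D tau
    & forall sigma sigma', D sigma -> D sigma' ->
        face (sigma `&` sigma') sigma /\ face (sigma `&` sigma') sigma'].

Definition dual_monoid sigma : set M :=
  [set u | forall v, sigma v -> 0 <= pairing (map_mx intr u) v].

Variables (C : numFieldType) (D : set (set NR)).

(* A point of U_sigma = Hom_monoid(S_sigma, C), together with the cone sigma;
   the function ev is extended by 0 outside S_sigma. *)
Record chart_pt := ChartPt {
  cone : set NR;
  ev : M -> C;
  _ : D cone;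
  _ : forall u, ~ dual_monoid cone u -> ev u = 0;
  _ : ev 0 = 1;
  _ : forall u v, dual_monoid cone u -> dual_monoid cone v ->
        ev (u + v) = ev u * ev v }.
HB.instance Definition _ := gen_eqMixin chart_pt.
HB.instance Definition _ := gen_choiceMixin chart_pt.

(* X(D) is glued from the U_sigma along the maps U_tau -> U_sigma given by
   restriction to S_sigma, for tau a face of sigma. *)
Definition glue (p q : chart_pt) :=
  face (cone p) (cone q) /\
  forall u, dual_monoid (cone q) u -> ev p u = ev q u.

Definition glue_rel (p q : chart_pt) : bool :=
  `[< clos_refl_sym_trans _ glue p q >].

Lemma glue_refl : reflexive glue_rel.
Proof. by move=> p; apply/asboolP; apply: rst_refl. Qed.

Lemma glue_sym : symmetric glue_rel.
Proof.
by move=> p q; apply/asboolP/asboolP; apply: rst_sym.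
Qed.

Lemma glue_trans : transitive glue_rel.
Proof.
move=> q p r /asboolP pq /asboolP qr; apply/asboolP.
exact: rst_trans pq qr.
Qed.

Canonical glue_equiv := EquivRel glue_rel glue_refl glue_sym glue_trans.

Definition toric_pt := {eq_quot glue_equiv}.
HB.instance Definition _ := Choice.on toric_pt.

Definition tpt (p : chart_pt) : toric_pt := \pi p.

Definition toric : space C := {|
  pts := toric_pt;
  idx := {sigma | D sigma};
  dom := fun s => tpt @` [set p | cone p = sval s];
  coord := fun s => [set a |
    algspan [set f | exists2 u, dual_monoid (sval s) u &
                     f = fun p : {p | cone p = sval s} => ev (sval p) u]
      (fun p => a (tpt (sval p)))] |}.

Program Definition chart_act (t : torus C n) (p : chart_pt) : chart_pt :=
  @ChartPt (cone p) (fun u => chi u t * ev p u) _ _ _ _.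
Next Obligation. by move=> t []. Qed.
Next Obligation. by move=> t [s e Ds e0 e1 eM] u /e0 /= ->; rewrite mulr0. Qed.
Next Obligation. by move=> t [s e Ds e0 e1 eM] /=; rewrite chi0 e1 mulr1. Qed.
Next Obligation.
move=> t [s e Ds e0 e1 eM] u v /= su sv.
by rewrite chiD eM // mulrACA.
Qed.

Definition toric_act (t : torus C n) (x : pts toric) : pts toric :=
  tpt (chart_act t (repr (x : toric_pt))).

Lemma toric_actE t p : toric_act t (tpt p) = tpt (chart_act t p).
Proof.
have lift q r : clos_refl_sym_trans _ glue q r ->
    glue_rel (chart_act t q) (chart_act t r).
  elim=> {q r} [q r [qr e]|q|q r _|q r u _ qr _ ru].
  - apply/asboolP; apply: rst_step; split=> // u ru /=.
    by rewrite e.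
  - exact: glue_refl.
  - by rewrite glue_sym.
  - exact: glue_trans qr ru.
apply/eqquotP/lift/asboolP.
suff : \pi_(toric_pt) (repr (tpt p)) = \pi_(toric_pt) p by move/eqquotP.
exact: reprK.
Qed.
End Toric.

Section Cellular.
Variables (C : numFieldType) (n : nat) (V : space C).
Variable act : torus C n -> pts V -> pts V.

Definition fixed_pt (p : pts V) := forall t, act t p = p.

Definition plus_cell (l : 'rV[int]_n) (x : pts V) : set (pts V) :=
  [set p | (fun s : C => act (ops l s) p) @ 0^' --> x].

Definition tstable (Z : set (pts V)) := forall t p, Z p -> Z (act t p).

(* algebraic representations of T: the entries are Laurent polynomials *)
Definition linear_action (d : nat) (rho : torus C n -> 'M[C]_d) :=
  [/\ rho (torus1 C n) = 1%:M,
      forall s t, rho (torusM s t) = rho s *m rho t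
    & forall i j, algspan (range (@chi C n)) (fun t => rho t i j)].

Definition equiv_iso (d : nat) (rho : torus C n -> 'M[C]_d) (Y : set (pts V)) :=
  exists (phi : 'cV[C]_d -> pts V) (psi : pts V -> 'cV[C]_d),
    [/\ @zmorphism C (affine_space C d) V setT Y phi,
        @zmorphism C V (affine_space C d) Y setT psi,
        cancel phi psi, {in Y, cancel psi phi}
      & forall t z, phi (rho t *m z) = act t (phi z)].

(* T-cellularity with respect to a chosen generic one-parameter subgroup l,
   ordering x of the fixed points and filtration Z. Indices start at 0: Z i and
   x i are the Z_(i+1) and x_(i+1) of the usual numbering from 1. *)
Definition cellular_data (m : nat) (x : 'I_m -> pts V) (l : 'rV[int]_n)
    (Z : nat -> set (pts V)) :=
  [/\ injective x /\ (forall p, fixed_pt p <-> exists i, p = x i),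
      forall p, (forall s : C, s != 0 -> act (ops l s) p = p) <-> fixed_pt p,
      forall p, exists i, plus_cell l (x i) p,
      [/\ Z 0%N = setT, Z m = set0,
          forall i, (i < m)%N -> Z i.+1 `<=` Z i,
          forall i, (i <= m)%N -> zclosed (Z i) /\ tstable (Z i)
        & forall i : 'I_m, Z i `\` Z i.+1 = plus_cell l (x i)]
    & forall i, exists (d : nat) (rho : torus C n -> 'M[C]_d),
        linear_action rho /\ equiv_iso rho (plus_cell l (x i))].

Definition weight_rep (d : nat) (u : 'I_d -> 'rV[int]_n) (t : torus C n) :
    'M[C]_d := diag_mx (\row_j chi (u j) t).
End Cellular.

Definition module_basis (A : pzRingType) (L : lmodType A) (m : nat)
    (f : 'I_m -> L) :=
  (forall g, exists a : 'I_m -> A, g = \sum_j a j *: f j) /\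
  (forall a : 'I_m -> A, \sum_j a j *: f j = 0 -> forall j, a j = 0).

(* Main.v *)
Require Import Defs.
From mathcomp Require Import all_boot all_order all_algebra finmap.
From mathcomp Require Import -(notations) monalg.
From mathcomp Require Import all_classical reals topology normedtype fsbigop.
From mathcomp Require Import complex mxtens fraction ring.

Import Order.TTheory GRing.Theory Num.Theory.
Local Open Scope ring_scope.

Set Implicit Arguments.
Unset Strict Implicit.
Unset Printing Implicit Defensive.

(** Restriction to a torus-fixed point [x] is a map of modules over the
    character ring, so the formula is back substitution in a triangular system:
    after the terms [a j *: f j] with [j > i] are removed from [g], the
    restriction to [x i] kills the terms with [j < i] ([hoff]) and leaves [a i]
    times the diagonal entry [hdiag].  Two facts have to be established.

    Linearity of the restriction ([krestrD], [krestrZ]).  The class of a fibre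
    is the generating function of its weight multiplicities, so linearity
    reduces to three properties of the dimension of a weight space: it is
    invariant under isomorphism ([weight_dim_iso]), additive on direct sums
    ([weight_dim_dsum]), and shifted by [u] when the representation is
    multiplied by the character [u] ([weight_dim_twist]).  That only
    finitely many weights occur ([finite_weights]), without which the generating
    function would collapse to [0], holds because weight vectors of distinct
    weights are linearly independent; this in turn needs that distinct
    characters differ on the compact torus ([tcomp_separates]).

    Nonvanishing of the diagonal entry.  The character ring is a domain, so it
    suffices that each weight [u i r] of a cell is nonzero.  A zero weight would
    make a whole coordinate line of the cell fixed by the torus, whereas there
    are only finitely many fixed points ([plus_cell_weight_neq0]). *)

(** * Characters of the compact torus *)

Section Separation.
Variable C : numClosedFieldType.

(** The Cayley transform of the real number [s]: an explicit infinite family of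
    points of the unit circle. *)
Definition cayley (s : nat) : C := (1 + 'i * s%:R) / (1 - 'i * s%:R).

Lemma cayley_den_neq0 s : 1 - 'i * s%:R != 0 :> C.
Proof.
apply/eqP => /eqP; rewrite subr_eq0 => /eqP e.
have : 1 + s%:R ^+ 2 = 0 :> C.
  have := congr1 (fun z => z ^+ 2) e; rewrite expr1n exprMn sqrCi mulN1r => e2.
  by rewrite [X in X + _]e2 addNr.
by apply/eqP; rewrite gt_eqF // ltr_wpDr ?ltr01 // exprn_ge0 // ler0n.
Qed.

Lemma norm_cayley s : `|cayley s| = 1.
Proof.
have cj : 1 + 'i * s%:R = (1 - 'i * s%:R)^* :> C.
  by rewrite rmorphB rmorphM /= conjCi rmorph1 conjC_nat mulNr opprK.
by rewrite normf_div cj norm_conjC divff // normr_eq0 cayley_den_neq0.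
Qed.

Lemma cayley_inj : injective cayley.
Proof.
move=> s t /eqP; rewrite eqr_div ?cayley_den_neq0 // -subr_eq0 => /eqP e.
have : 2%:R * 'i * (s%:R - t%:R) = 0 :> C by rewrite -[RHS]e; ring.
move/eqP; rewrite !mulf_eq0 (negPf (neq0Ci C)) pnatr_eq0 /= subr_eq0.
by rewrite eqr_nat => /eqP.
Qed.

(** The unit circle is infinite, while [z ^ k = 1] has at most [`|k|]
    solutions. *)
Lemma unit_circle_not_root (k : int) : k != 0 -> exists2 z : C, `|z| = 1 & z ^ k != 1.
Proof.
move=> k0; pose N := absz k.
have N0 : (0 < N)%N by rewrite absz_gt0.
have [s sN] : exists s, cayley s ^+ N != 1.
  apply/not_existsP => h.
  have h1 s : cayley s ^+ N = 1 by apply/eqP/negPn/negP; exact: h.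
  pose rs := [seq cayley s | s <- iota 0 N.+1].
  have p0 : 'X^N - 1 != 0 :> {poly C} by rewrite -size_poly_eq0 size_XnsubC.
  have all_r : all (root ('X^N - 1)) rs.
    apply/allP => _ /mapP[s _ ->]; rewrite /root !hornerE.
    by rewrite h1 subrr.
  have urs : uniq rs by rewrite map_inj_uniq ?iota_uniq //; exact: cayley_inj.
  have := max_poly_roots p0 all_r urs.
  by rewrite size_map size_iota size_XnsubC // ltnn.
exists (cayley s); first exact: norm_cayley.
move: sN; rewrite /N; case: k {N N0 k0} => k //=.
by apply: contraNneq; rewrite NegzE /exprz => /eqP; rewrite invr_eq1.
Qed.

(** A separating element can be taken with a single coordinate different from
    [1], at an index where [u] and [v] differ. *)
Lemma tcomp_separates n (u v : 'rV[int]_n) : u != v ->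
  exists2 t : torus C n, tcomp t & chi u t != chi v t.
Proof.
move=> uv; have [i ui] : exists i, u 0 i != v 0 i.
  apply/not_existsP => h; case/eqP: uv; apply/rowP => i.
  by apply/eqP/negPn/negP; exact: h.
have [|z z1 zk] := unit_circle_not_root (k := u 0 i - v 0 i); first by rewrite subr_eq0.
have z0 : z != 0 by rewrite -normr_eq0 z1 oner_eq0.
have tP : [forall j, (\row_j (if j == i then z else 1) : 'rV[C]_n) 0 j != 0].
  by apply/forallP => j; rewrite mxE; case: ifP; rewrite ?oner_eq0.
pose t := Torus tP.
have chit w : chi w t = z ^ w 0 i.
  rewrite /chi (bigD1 i) //= mxE eqxx big1 ?mulr1 // => j /negPf ji.
  by rewrite mxE ji exp1rz.
exists t; first by move=> j; rewrite mxE; case: ifP; rewrite ?normr1.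
rewrite !chit; apply: contraNneq zk => e.
by rewrite expfzDr // e -expfzDr // subrr expr0z.
Qed.
End Separation.

(** * Weight spaces of a family of matrices *)

Section WeightSpaces.
Variables (C : numFieldType) (n : nat).
Implicit Types (u v : 'rV[int]_n) (t : torus C n).

(** The columns of [A] are weight vectors of weight [u].  Matrices are used
    instead of subspaces because the weight space is an intersection of
    infinitely many eigenspaces, one for each element of the compact torus. *)
Definition weight_mx d (L : torus C n -> 'M[C]_d) u r (A : 'M[C]_(d, r)) :=
  forall t, tcomp t -> L t *m A = chi u t *: A.

(** [wdim E x u] is [weight_dim (fun t => lin E t x x) u] by conversion; a plain
    family of matrices frees the linear algebra from bundles, and from the group
    law of the torus. *)
Definition weight_dim d (L : torus C n -> 'M[C]_d) u : nat :=
  \max_(r < d.+1 |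
    `[< exists2 A : 'M[C]_(d, r), \rank A = r & weight_mx L u A >]) r.

Section OneFamily.
Variables (d : nat) (L : torus C n -> 'M[C]_d) (u : 'rV[int]_n).

Lemma weight_mxM r s (A : 'M[C]_(d, r)) (B : 'M[C]_(r, s)) :
  weight_mx L u A -> weight_mx L u (A *m B).
Proof. by move=> wA t tc; rewrite mulmxA wA // scalemxAl. Qed.

Lemma weight_dim_max :
  exists2 A : 'M[C]_(d, weight_dim L u),
    \rank A = weight_dim L u & weight_mx L u A.
Proof.
pose P (r : 'I_d.+1) :=
  `[< exists2 A : 'M[C]_(d, r), \rank A = r & weight_mx L u A >].
have P0 : P ord0.
  apply/asboolP; exists 0; first exact: mxrank0.
  by move=> t _; rewrite mulmx0 scaler0.
have -> : weight_dim L u = [arg max_(r > ord0 | P r) r] by exact: bigmax_eq_arg.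
by case: arg_maxnP => // r /asboolP.
Qed.

(** The columns of [A] need not be independent: [col_base A] has the same rank
    and is [A] times a matrix, so its columns are weight vectors too.  Together
    with [weight_dim_max] this characterizes the dimension. *)
Lemma weight_rank_le r (A : 'M[C]_(d, r)) :
  weight_mx L u A -> (\rank A <= weight_dim L u)%N.
Proof.
move=> wA; have lt : (\rank A < d.+1)%N by rewrite ltnS rank_leq_row.
apply: (@leq_bigmax_cond _ _ (fun r : 'I_d.+1 => r : nat) (Ordinal lt)) => /=.
apply/asboolP; exists (col_base A).
  by have := col_base_full A; rewrite /row_full => /eqP.
have -> : col_base A = A *m pinvmx (row_base A).
  have := congr1 (mulmx^~ (pinvmx (row_base A))) (mulmx_base A).
  by rewrite -mulmxA mulmxVp ?row_base_free // mulmx1.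
exact: weight_mxM.
Qed.

Lemma weight_dim_neq0 : weight_dim L u != 0%N ->
  exists2 c : 'cV[C]_d, c != 0 & weight_mx L u c.
Proof.
case: weight_dim_max => A rA wA; rewrite -{1}rA mxrank_eq0 => A0.
have [j cj] : exists j, col j A != 0.
  apply/not_existsP => h; case/eqP: A0; apply/matrixP => i j; rewrite !mxE.
  have /eqP/(congr1 (fun M : 'cV_d => M i 0)) : col j A == 0.
    by apply/negPn/negP; exact: h.
  by rewrite !mxE.
by exists (col j A) => //; rewrite colE; exact: weight_mxM.
Qed.
End OneFamily.

Lemma weight_dim_le d d' (L : torus C n -> 'M[C]_d) (L' : torus C n -> 'M[C]_d')
    u u' (h : 'M[C]_(d', d)) (k : 'M[C]_(d, d')) :
  k *m h = 1%:M ->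
  (forall r (A : 'M[C]_(d, r)), weight_mx L u A -> weight_mx L' u' (h *m A)) ->
  (weight_dim L u <= weight_dim L' u')%N.
Proof.
move=> kh wh; case: (weight_dim_max L u) => A rA /wh/weight_rank_le.
apply: leq_trans; rewrite -{1}rA -{1}[A]mul1mx -kh -mulmxA.
exact: mxrankM_maxr.
Qed.

Lemma weight_dim_iso d d' (L : torus C n -> 'M[C]_d) (L' : torus C n -> 'M[C]_d')
    u (h : 'M[C]_(d', d)) (k : 'M[C]_(d, d')) :
  k *m h = 1%:M -> h *m k = 1%:M ->
  (forall t, tcomp t -> L' t *m h = h *m L t) ->
  weight_dim L u = weight_dim L' u.
Proof.
move=> kh hk hL; apply/eqP; rewrite eqn_leq; apply/andP; split.
  apply: (weight_dim_le kh) => r A wA t tc.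
  by rewrite mulmxA hL // -mulmxA wA // scalemxAr.
apply: (weight_dim_le hk) => r A wA t tc.
rewrite scalemxAr -wA // !mulmxA; congr (_ *m _).
by rewrite -[L t]mul1mx -kh -[k *m h *m L t]mulmxA -hL // -!mulmxA hk mulmx1.
Qed.

(** A block diagonal matrix of weight vectors gives one inequality; for the other,
    the two blocks of rows of a matrix of weight vectors consist of weight vectors
    of the summands, and the rank is subadditive. *)
Lemma weight_dim_dsum d d' (L : torus C n -> 'M[C]_d) (L' : torus C n -> 'M[C]_d') u :
  weight_dim (fun t => block_mx (L t) 0 0 (L' t)) u =
  (weight_dim L u + weight_dim L' u)%N.
Proof.
apply/eqP; rewrite eqn_leq; apply/andP; split; last first.
  case: (weight_dim_max L u) => A rA wA; case: (weight_dim_max L' u) => B rB wB.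
  rewrite -{1}rA -{1}rB -rank_diag_block_mx; apply: weight_rank_le => t tc.
  by rewrite mul_dsummx wA // wB // scale_block_mx !scaler0.
set s := weight_dim _ u.
case: (weight_dim_max (fun t => block_mx (L t) 0 0 (L' t)) u) => A; rewrite -/s => rA wA.
have wud t : tcomp t -> L t *m usubmx A = chi u t *: usubmx A /\
    L' t *m dsubmx A = chi u t *: dsubmx A.
  move=> tc; have := wA t tc; rewrite -[A]vsubmxK mul_block_col !mul0mx addr0 add0r.
  by rewrite scale_col_mx => /eq_col_mx; rewrite col_mxKu col_mxKd.
rewrite -rA -[A]vsubmxK -addsmxE.
apply: leq_trans (mxrank_adds_leqif _ _) _.
by apply: leq_add; apply: weight_rank_le => t /wud[].
Qed.

(** Since [chi u t] is invertible, the equations of weight [v] for the twisted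
    family are those of weight [v - u] for [L]. *)
Lemma weight_dim_twist d (L : torus C n -> 'M[C]_d) u v :
  weight_dim (fun t => ((chi u t)%:M : 'M_1) *t L t) v = weight_dim L (v - u).
Proof.
have chi_neq0 t : chi u t != 0.
  by apply/prodf_neq0 => i _; rewrite expfz_neq0 // torus_neq0.
have cast d' (e : d = d') (L' : torus C n -> 'M[C]_d) w :
    weight_dim (fun t => castmx (e, e) (L' t)) w = weight_dim L' w.
  by case: d' / e.
have -> : (fun t => ((chi u t)%:M : 'M_1) *t L t) =
    (fun t => castmx (esym (mul1n d), esym (mul1n d)) (chi u t *: L t)).
  by apply/funext => t; rewrite tens_scalar_mx.
have -> := @cast _ (esym (mul1n d)) (fun t => chi u t *: L t) v.
apply: eq_bigl => r; apply: asbool_equiv_eq; split => -[A rA wA];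
  exists A => // t tc.
- apply: (scalerI (chi_neq0 t)).
  by rewrite scalemxAl wA // scalerA -chiD addrC subrK.
- by rewrite -scalemxAl wA // scalerA -chiD addrC subrK.
Qed.
End WeightSpaces.

Section WeightsFinite.
Variables (C : numClosedFieldType) (n d : nat) (L : torus C n -> 'M[C]_d).

(** Eigenvectors of distinct eigenvalues are independent, by the usual induction:
    [L t] minus the scalar [chi u0 t] removes the first vector and, for a [t]
    separating [u0] from [u], keeps a nonzero multiple of [c u]. *)
Lemma weight_vectors_free (s : seq 'rV[int]_n) (c : 'rV[int]_n -> 'cV[C]_d) :
  uniq s -> (forall u, u \in s -> weight_mx L u (c u)) ->
  \sum_(u <- s) c u = 0 -> forall u, u \in s -> c u = 0.
Proof.
elim: s c => [//|u0 s IHs] c /= /andP[u0s us] wc; rewrite big_cons => sum0.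
have cs u : u \in s -> c u = 0.
  move=> uS; have u0u : u0 != u by apply: contraNneq u0s => ->.
  have [t tc tu] := tcomp_separates C u0u.
  pose c' v := (chi v t - chi u0 t) *: c v.
  have : c' u = 0.
    apply: (IHs c') => // [v vs|]; first rewrite /c'.
      move=> t' tc'; rewrite -scalemxAr wc ?in_cons ?vs ?orbT //.
      by rewrite !scalerA mulrC.
    have := congr1 (fun w => L t *m w - chi u0 t *: w) sum0.
    rewrite mulmx0 scaler0 subr0 mulmxDr scalerDr wc ?mem_head //.
    rewrite opprD addrACA subrr add0r mulmx_sumr scaler_sumr -sumrB; apply: etrans.
    apply: eq_big_seq => v vs.
    by rewrite wc ?in_cons ?vs ?orbT // /c' scalerBl.
  move/eqP; rewrite /c' scaler_eq0 subr_eq0 eq_sym (negPf tu) /=.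
  by move/eqP.
move=> u; rewrite in_cons => /orP[/eqP->|]; last exact: cs.
by move: sum0; rewrite big_seq big1 ?addr0.
Qed.

(** More than [d] weights would give more than [d] independent vectors in a space
    of dimension [d]. *)
Lemma finite_weights : finite_set [set u | weight_dim L u != 0%N].
Proof.
apply: contrapT => /(infinite_set_fset d.+1)[B BW]; apply/negP; rewrite -ltnNge ltnS.
have /choice[c cP] u : exists c : 'cV[C]_d, u \in B -> c != 0 /\ weight_mx L u c.
  case: (boolP (u \in B)) => uB; last by exists 0.
  by have [c c0 wc] := weight_dim_neq0 (BW u uB); exists c.
set s : seq _ := B; have us : uniq s := fset_uniq B.
pose A : 'M[C]_(size s, d) := \matrix_i (c (nth 0 s i))^T.
suff : row_free A by rewrite /row_free => /eqP <-; exact: rank_leq_col.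
apply: inj_row_free => v vA0; apply/rowP => i; rewrite mxE.
(* the coefficients of the relation, indexed by weights; 0 is a dummy value *)
pose w u : C := if insub (index u s) is Some j then v 0 j else 0.
have wE (j : 'I_(size s)) : w (nth 0 s j) = v 0 j.
  by rewrite /w index_uniq // valK.
have : w (nth 0 s i) *: c (nth 0 s i) = 0.
  apply: (@weight_vectors_free s (fun u => w u *: c u)) => //; last exact: mem_nth.
    by move=> u /cP[_ wc] t tc; rewrite -scalemxAr wc // !scalerA mulrC.
  rewrite (big_nth 0) big_mkord; apply: trmx_inj; rewrite raddf_sum trmx0 -[RHS]vA0.
  rewrite mulmx_sum_row; apply: eq_bigr => j _ /=.
  by rewrite linearZ /= wE rowK.
have /cP[c0 _] : nth 0 s i \in B by exact: mem_nth.
by move/eqP; rewrite scaler_eq0 (negPf c0) orbF wE => /eqP.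
Qed.
End WeightsFinite.

(** * Restriction to a fixed point is linear over the character ring *)

Section CharacterRing.
Variable n : nat.
Implicit Types (u v : 'rV[int]_n) (g h : charring n).

Lemma charringP g h : (forall u, coefc g u = coefc h u) -> g = h.
Proof. by move=> e; apply/malgP. Qed.

Lemma coefcD g h u : coefc (g + h) u = coefc g u + coefc h u.
Proof. exact: mcoeffD. Qed.

Lemma coefc_expcM u g v : coefc (expc u * g) v = coefc g (v - u).
Proof.
change (coefc (Defs.mulc (expc u) g) v = coefc g (v - u)).
rewrite mulcUg /coefc raddf_sum /=.
case: (boolP (v - u \in suppc g)) => vg.
  rewrite (big_fsetD1 _ vg) /= subrKC mcoeffUU mul1r big1_fset ?addr0 //.
  move=> w; rewrite in_fsetD1 => /andP[wv _] _; rewrite mcoeffU.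
  by case: eqP => // e; case/eqP: wv; rewrite -e addrC addKr.
rewrite (mcoeff_outdom vg) big1_fset // => w wg _; rewrite mcoeffU.
by case: eqP => // e; case/negP: vg; rewrite -e addrC addKr.
Qed.

(** The finiteness assumption is essential: the sum over an infinite support is
    [0] by convention. *)
Lemma coefc_sum_expc (w : 'rV[int]_n -> nat) v :
  finite_set [set u | w u != 0%N] ->
  coefc (\sum_(u \in [set: 'rV[int]_n]) expc u *+ w u) v = (w v)%:Z.
Proof.
move=> fw; rewrite -(@fsbig_widen _ _ _ _ [set u | w u != 0%N]) //=; last first.
  by move=> u /= [_ /negP/negPn/eqP ->].
rewrite fsbig_finite // /coefc raddf_sum /=.
have cE u : mcoeff v (expc u *+ w u) = (if u == v then w u else 0%N)%:Z.
  by rewrite raddfMn /= mcoeffU; case: eqP; rewrite ?mul0rn // natz.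
under eq_bigr do rewrite cE.
case: (boolP (v \in fset_set [set u | w u != 0%N])) => vw.
  rewrite (big_fsetD1 _ vw) /= eqxx big1_fset ?addr0 // => u.
  by rewrite in_fsetD1 => /andP[/negPf -> _] _.
rewrite big1_fset => [|u uw _]; last by case: eqP uw vw => // -> ->.
congr Posz; apply/esym/eqP; apply: contraNT vw => wv.
by rewrite in_fset_set //; exact/mem_set.
Qed.

Lemma one_sub_expc_neq0 u : u != 0 -> 1 - expc (- u) != 0 :> charring n.
Proof.
move=> u0; rewrite subr_eq0; apply/eqP => /(congr1 (fun g => coefc g 0)).
rewrite /coefc /expc [1]/(expc 0) !mcoeffU eqxx oppr_eq0 (negPf u0).
by move/eqP.
Qed.
End CharacterRing.

Section FixedPoint.
Variables (C : numClosedFieldType) (n : nat) (X : topologicalType).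
Variables (act : torus C n -> X -> X) (x : X).
Hypothesis fixed : forall t, tcomp t -> act t x = x.
Implicit Types (E F : eqbundle act) (u : 'rV[int]_n) (f g : K0 act).

Lemma coefc_fibre_char E u : coefc (fibre_char E x) u = (wdim E x u)%:Z.
Proof. exact/coefc_sum_expc/(finite_weights (fun t => lin E t x x)). Qed.

(** At a fixed point equivariance of a bundle map says that its matrix intertwines
    the two representations on the fibres. *)
Lemma fibre_char_iso E F : bundle_iso E F -> fibre_char E x = fibre_char F x.
Proof.
move=> [h [k [[_ hL] _ kh hk]]]; apply: charringP => u.
rewrite !coefc_fibre_char; congr Posz.
apply: (weight_dim_iso _ (kh x) (hk x)) => t tc.
by have := hL t x tc; rewrite fixed.
Qed.

Lemma fibre_char_dsum E F :
  fibre_char (dsum E F) x = fibre_char E x + fibre_char F x.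
Proof.
apply: charringP => u; rewrite coefcD !coefc_fibre_char -PoszD; congr Posz.
exact: (weight_dim_dsum (fun t => lin E t x x) (fun t => lin F t x x)).
Qed.

Lemma fibre_char_tens_line E u :
  fibre_char (tens (lineb act u) E) x = expc u * fibre_char E x.
Proof.
apply: charringP => v; rewrite coefc_expcM !coefc_fibre_char; congr Posz.
exact: (weight_dim_twist (fun t => lin E t x x)).
Qed.

Definition vect_char (v : vect act) : charring n := fibre_char (vrepr v) x.

Lemma vect_charE E : vect_char (vclass E) = fibre_char E x.
Proof. exact/fibre_char_iso/vrepr_iso. Qed.

Lemma vect_charD (v w : vect act) : vect_char (v + w) = vect_char v + vect_char w.
Proof. by rewrite [v + w]/(vadd v w) /vadd vect_charE fibre_char_dsum. Qed.

Lemma vect_char_lineM u (v : vect act) :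
  vect_char (vclass (lineb act u) * v) = expc u * vect_char v.
Proof. by rewrite -{1}[v]vreprK [_ * _]vclassM vect_charE fibre_char_tens_line. Qed.

(** [krestr] is computed on a chosen representative of the formal difference; by
    additivity and cancellation in the character ring any representative gives the
    same value. *)
Lemma krestr_gdiff (p : vect act * vect act) :
  krestr x (gdiff p : K0 act) = vect_char p.1 - vect_char p.2.
Proof.
have [g] := gdiff_repr p; rewrite /krestr; case: (repr _) => v w /=.
move/(congr1 vect_char); rewrite !vect_charD => /addIr e.
apply/eqP; rewrite subr_eq addrAC eq_sym subr_eq -/(vect_char _).
by rewrite -/(vect_char w) -e.
Qed.

Lemma krestrD f g : krestr x (f + g) = krestr x f + krestr x g.
Proof.
rewrite -[f]gdiffK -[g]gdiffK [_ + _ in LHS]gdiffD !krestr_gdiff /=.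
by rewrite !vect_charD opprD addrACA.
Qed.

Lemma krestr0 : krestr x (0 : K0 act) = 0.
Proof. by apply: (addrI (krestr x (0 : K0 act))); rewrite -krestrD !addr0. Qed.

Lemma krestrN f : krestr x (- f) = - krestr x f.
Proof. by apply/eqP; rewrite -addr_eq0 -krestrD addNr krestr0. Qed.

Lemma krestr_sum I (r : seq I) (P : pred I) (F : I -> K0 act) :
  krestr x (\sum_(i <- r | P i) F i) = \sum_(i <- r | P i) krestr x (F i).
Proof. exact: (big_morph _ krestrD krestr0). Qed.

Lemma krestr_lineM u f :
  krestr x (kclass (lineb act u) * f) = expc u * krestr x f.
Proof.
rewrite -[f]gdiffK [_ * _ in LHS]gdiffM !krestr_gdiff /=.
by rewrite !mul0r !addr0 !vect_char_lineM mulrBr.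
Qed.

Lemma krestrMz f (z : int) : krestr x (f *~ z) = krestr x f *~ z.
Proof.
have nat k : krestr x (f *+ k) = krestr x f *+ k.
  by elim: k => [|k IH]; rewrite ?krestr0 // !mulrS krestrD IH.
by case: z => k; rewrite ?NegzE ?mulrNz ?krestrN -!pmulrn nat.
Qed.

(** Scalars act through the classes of the line bundles [X x C_u], so that
    linearity follows from additivity and [krestr_lineM]. *)
Lemma krestrZ (a : charring n) f : krestr x (a *: f) = a * krestr x f.
Proof.
rewrite [a *: f]/(kscale a f) /kscale /kscalar mulr_suml krestr_sum.
rewrite [in RHS](monalgE a : a = _) mulr_suml; apply: eq_bigr => u _.
rewrite mulrzAl krestrMz krestr_lineM -mulrzAl; congr (_ * _).
by apply: charringP => v; rewrite /coefc raddfMz /= !mcoeffU -mulrzl intz;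
  case: eqP; rewrite ?mulr1 ?mulr0.
Qed.
End FixedPoint.

(** * Weights of a cell and the coefficient formula *)

(** If [u r = 0], the points [0, ..., m] of the [r]-th coordinate line of the cell
    are [m + 1] distinct fixed points, one more than there are. *)
Lemma plus_cell_weight_neq0 (C : numFieldType) (n : nat) (V : Defs.space C)
    (act : torus C n -> pts V -> pts V) (m : nat) (x : 'I_m -> pts V)
    (d : nat) (u : 'I_d -> 'rV[int]_n) (Y : set (pts V)) :
  (forall p, fixed_pt act p -> exists i, p = x i) ->
  equiv_iso act (weight_rep (C := C) u) Y -> forall r, u r != 0.
Proof.
move=> fx [phi [psi [_ _ phiK _ phi_act]]] r; apply/eqP => ur0.
pose z (j : 'I_m.+1) : 'cV[C]_d := j%:R *: delta_mx r 0.
have fixz j : fixed_pt act (phi (z j)).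
  move=> t; rewrite -phi_act; congr phi; apply/colP => i.
  rewrite /weight_rep mul_diag_mx !mxE.
  by case: eqP => [->|_]; rewrite ?ur0 ?chi0 ?mul1r // andFb !mulr0.
have /choice[s sE] j : exists i, phi (z j) = x i by exact: fx.
have /leq_card : injective s.
  move=> i j sij; apply/val_inj/eqP; rewrite -(eqr_nat C); apply/eqP.
  have : z i = z j by apply: (can_inj phiK); rewrite !sE sij.
  by move/colP/(_ r); rewrite !mxE !eqxx !mulr1.
by rewrite !card_ord ltnn.
Qed.

Theorem theorem6p3 (R : realType) (n : nat)
  (D : set (set 'rV[R]_n)) (hD : fan D)
  (hcomplete : complete_variety (toric R[i] D))
  (m : nat) (x : 'I_m -> pts (toric R[i] D))
  (l : 'rV[int]_n) (Z : nat -> set (pts (toric R[i] D)))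
  (hcell : cellular_data (@toric_act R n R[i] D) x l Z)
  (k : 'I_m -> nat) (hk : forall i, (k i <= n)%N)
  (u : forall i : 'I_m, 'I_(n - k i) -> 'rV[int]_n)
  (hu : forall i : 'I_m,
    equiv_iso (@toric_act R n R[i] D) (weight_rep (u i))
      (plus_cell (@toric_act R n R[i] D) l (x i)))
  (f : 'I_m -> K0 (@toric_act R n R[i] D))
  (hbasis : module_basis f)
  (hdiag : forall i : 'I_m,
    krestr (x i) (f i) = \prod_(r < n - k i) (1 - expc (- u i r)))
  (hoff : forall i j : 'I_m, (i < j)%N -> krestr (x j) (f i) = 0)
  (g : K0 (@toric_act R n R[i] D)) (a : 'I_m -> charring n)
  (hg : g = \sum_(j < m) a j *: f j) :
  forall i : 'I_m,
    \prod_(r < n - k i) (1 - expc (- u i r)) != 0 /\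
    tofrac (a i) =
      tofrac (krestr (x i) (g - \sum_(j < m | (i < j)%N) a j *: f j)) /
      tofrac (\prod_(r < n - k i) (1 - expc (- u i r)))
      :> {fraction charring n}.
Proof.
move=> i; have [[_ fixedP] _ _ _ _] := hcell.
have fixi t : toric_act t (x i) = x i by have [_ ->] := fixedP (x i); last exists i.
have dE : \prod_(r < n - k i) (1 - expc (- u i r)) != 0.
  apply/prodf_neq0 => r _; apply: one_sub_expc_neq0.
  exact: (plus_cell_weight_neq0 (fun p => iffLR (fixedP p)) (hu i)).
split=> //.
have -> : krestr (x i) (g - \sum_(j < m | (i < j)%N) a j *: f j) =
    a i * \prod_(r < n - k i) (1 - expc (- u i r)).
  (* the sum over i < j cancels, which leaves the indices j <= i *)
  rewrite hg (bigID (fun j : 'I_m => (i < j)%N)) /= addrAC subrr add0r.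
  rewrite krestr_sum => [|t _]; last exact: fixi.
  rewrite (bigD1 i) ?ltnn //= krestrZ // hdiag [X in _ + X]big1 ?addr0 // => j.
  rewrite -leqNgt => /andP[ji ne].
  by rewrite krestrZ // hoff ?mulr0 // ltn_neqAle ne.
by rewrite rmorphM mulfK // tofrac_eq0.
Qed.
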